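(* Let $\Psi:\mathbb R\to\mathbb C$ be a wavelet whose spectrum $\widehat\Psi$ is a compactly supported integrable signal, i.e. $\Psi(x)=\frac1{2\pi}\int_{\mathbb R}\widehat\Psi(\xi)e^{ix\xi}\,d\xi$ with $\widehat\Psi\in L^1(\mathbb R)$ compactly supported. For $(\tau,\alpha,\omega)\in\mathbb R^3$ let $(t,x)\in\,]0,+\infty[\times\mathbb R\mapsto\psi_{\tau,\alpha,\omega}(t,x)$ be the evolution under the free Schrödinger Cauchy problem of the translated, scaled and modulated atom $$x\mapsto2^{-\alpha/2}\,\Psi\Big(\frac{x-\tau}{2^\alpha}\Big)e^{i\omega x}.$$ Then, for every $(\tau,\alpha,\omega)\in\mathbb R^3$, $\psi_{\tau,\alpha,\omega}$ is the uniform limit on any compact subset of $]0,+\infty[\times\mathbb R$ of the functions $$\sum_{\nu\prec N}\binom{N}{\nu}\Big(\frac{1-(\tau,\alpha,\omega)}{2}\Big)^{\nu}\Big(\frac{1+(\tau,\alpha,\omega)}{2}\Big)^{N-\nu}\psi_{\mathbf 1-2\nu/N},\qquad N=(N_1,N_2,N_3)\in(\mathbb N^* )^3,$$ when $\min(N_1,N_2,N_3)\to+\infty$.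
   Context: The free Schrödinger Cauchy problem is $\big(i\frac{\partial}{\partial t}+\frac{\partial^2}{\partial x^2}\big)\psi(t,x)=0$ $(t>0,\ x\in\mathbb R)$, $\psi(0,x)=\varphi(x)$. The evolution of $\varphi$ is $\psi(t,x)=\int_{\mathbb R}\varphi(y)\,\mathcal G_0(t,x-y)\,dy$ with $\mathcal G_0(t,x)=\frac1{\sqrt{4i\pi t}}\exp\big(i\frac{x^2}{4t}\big)$, $\sqrt{i}=e^{i\pi/4}$, the integral being understood as a (possibly conditionally convergent) oscillatory integral. $\mathbb N^*$ is the set of positive integers; $\nu\prec N$ means $\nu\in\mathbb N^3$ with $0\le\nu_j\le N_j$ for all $j$; $\mathbf 1-2\nu/N=(1-2\nu_1/N_1,1-2\nu_2/N_2,1-2\nu_3/N_3)$, and $\psi_{\mathbf 1-2\nu/N}$ is $\psi_{\tau',\alpha',\omega'}$ with $(\tau',\alpha',\omega')=\mathbf 1-2\nu/N$. For $a=(a_1,a_2,a_3)\in\mathbb R^3$, $$\binom{N}{\nu}\Big(\frac{1-a}{2}\Big)^{\nu}\Big(\frac{1+a}{2}\Big)^{N-\nu}:=\prod_{j=1}^3\binom{N_j}{\nu_j}\Big(\frac{1-a_j}{2}\Big)^{\nu_j}\Big(\frac{1+a_j}{2}\Big)^{N_j-\nu_j}.$$ *)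

(* Defs.v *)
From HB Require Import structures.
From mathcomp Require Import all_boot all_order all_algebra.
From mathcomp Require Import all_classical all_reals all_analysis.
From mathcomp Require Import complex.

Set Implicit Arguments.
Unset Strict Implicit.
Unset Printing Implicit Defensive.

Import Order.TTheory GRing.Theory Num.Theory.
Import numFieldNormedType.Exports.

Local Open Scope classical_set_scope.
Local Open Scope ring_scope.
Local Open Scope complex_scope.

Section Defs.
Context {R : realType}.

Definition expi (theta : R) : R[i] := cos theta +i* sin theta.

Definition complex_integrable (D : set R) (f : R -> R[i]) : Prop :=
  (@lebesgue_measure R).-integrable D (EFin \o @complex.Re R \o f) /\
  (@lebesgue_measure R).-integrable D (EFin \o @complex.Im R \o f).

Definition complex_integral (D : set R) (f : R -> R[i]) : R[i] :=
  (\int[@lebesgue_measure R]_(x in D) @complex.Re R (f x)) +i*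
  (\int[@lebesgue_measure R]_(x in D) @complex.Im R (f x)).

Definition compactly_supported (f : R -> R[i]) : Prop :=
  compact (closure [set xi | f xi != 0]).

(* The denominator is sqrt(4 i pi t), with sqrt i = e^(i pi / 4). *)
Definition schrodinger_kernel (t x : R) : R[i] :=
  expi (x ^+ 2 / (4 * t)) / (expi (pi / 4) * (Num.sqrt (4 * pi * t))%:C).

Definition truncated_evolution (phi : R -> R[i]) (t x : R) (ab : R * R) :
    R[i]^o :=
  complex_integral `[ab.1, ab.2]
    (fun y => phi y * schrodinger_kernel t (x - y)).

(* The oscillatory integral over the real line is the limit of the integrals
   over [a, b] as a and b tend independently to -oo and +oo. *)
Definition evolution_filter (phi : R -> R[i]) (t x : R) : set_system R[i]^o :=
  truncated_evolution phi t x @ filter_prod (-oo)%R (+oo)%R.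

Definition evolution (phi : R -> R[i]) (t x : R) : R[i]^o :=
  lim (evolution_filter phi t x).

Definition atom (Psi : R -> R[i]) (tau alpha omega x : R) : R[i] :=
  (2 `^ (- (alpha / 2)))%:C * Psi ((x - tau) / 2 `^ alpha) * expi (omega * x).

Definition psi (Psi : R -> R[i]) (tau alpha omega : R) (tx : R * R) : R[i]^o :=
  evolution (atom Psi tau alpha omega) tx.1 tx.2.

Definition weight (N nu : nat) (a : R) : R :=
  'C(N, nu)%:R * ((1 - a) / 2) ^+ nu * ((1 + a) / 2) ^+ (N - nu).

(* The node 1 - 2 nu / N; meaningful only for N > 0. *)
Definition node (N nu : nat) : R := 1 - 2 * nu%:R / N%:R.

Definition approximant (Psi : R -> R[i]) (tau alpha omega : R)
    (N : nat * nat * nat) (tx : R * R) : R[i]^o :=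
  let: (N1, N2, N3) := N in
  \sum_(nu1 < N1.+1) \sum_(nu2 < N2.+1) \sum_(nu3 < N3.+1)
    (weight N1 nu1 tau * weight N2 nu2 alpha * weight N3 nu3 omega)%:C *
    psi Psi (node N1 nu1) (node N2 nu2) (node N3 nu3) tx.

End Defs.

(* The filter min(N1, N2, N3) -> +oo on triples. Every triple is eventually
   positive, so that it is also the filter on triples of positive integers. *)
Definition min_to_infty : set_system (nat * nat * nat) :=
  filter_prod (filter_prod \oo \oo) \oo.

(* Main.v *)
Require Import Defs.
From HB Require Import structures.
From mathcomp Require Import all_boot all_order all_algebra.
From mathcomp Require Import all_classical all_reals all_analysis.
From mathcomp Require Import measurable_realfun complex ring lra zify.

Import Order.TTheory GRing.Theory Num.Theory.
Import numFieldNormedType.Exports.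

Local Open Scope classical_set_scope.
Local Open Scope ring_scope.
Local Open Scope complex_scope.

(** The idea of the proof.

    A plane wave of wave number k evolves into exp(i (k x - t k^2)), and the
    component of frequency xi of the spectrum of Psi contributes to the atom of
    parameters (tau, alpha, omega) the wave number
    k = xi / 2^alpha + omega. Hence [evolution_spectral]
    - psi_(tau,alpha,omega)(t, x) = kap * int Psihat(xi) W(xi) d xi,
      W(xi) = 2^(- alpha / 2) exp(i (- tau xi / 2^alpha + k x - t k^2)),
    where kap is an absolute constant. The convolution with the kernel is
    truncated to a segment, Fubini is applied and the square is completed:
    what remains is a Fresnel integral whose end points go to infinity
    uniformly for xi in the bounded support of Psihat, and Fresnel integrals
    converge with an explicit rate [fresnel_cvg]. The constant kap contains
    their limit; it is a common factor of psi and of all the approximants.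

    For fixed (t, x, xi), W is a power series in (tau, alpha, omega) which
    converges everywhere. Its coefficients, weighted by the powers of any
    fixed radius, have a sum bounded uniformly for (t, x) in a compact set and
    xi in the support [spectral_wave_majorized]. Therefore it suffices to study
    the approximation scheme on power series. That scheme is the tensor product
    of three Bernstein operators for the segment [-1, 1], evaluated at a point
    which may lie outside the cube.

    At a, the Bernstein operator of degree N maps x^m to the m-th moment of the
    mean of N independent signs, equal to 1 with the possibly negative
    probability weight (1 + a) / 2. If 1 <= A and |a| <= A, expanding the m-th
    power over the maps from m points to N signs shows that this moment is at
    most A^m and, injective maps being the vast majority, that it differs from
    a^m by at most (4 A)^m / N [bernstein_exp_sub]. A power series with weighted
    coefficient sum C at radius 4 A is thus approximated up to
    C (1 / N1 + 1 / N2 + 1 / N3) [bernstein3_sub], which gives the uniform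
    convergence after integration against Psihat. *)

(** * Bernstein operators and monomials *)

Section Bernstein.
Context {R : realType}.
Implicit Types (a A : R) (N m : nat).

(** The Bernstein polynomial of f for the segment [-1, 1], evaluated at a. *)
Definition bernstein N a (f : R -> R) : R :=
  \sum_(nu < N.+1) weight N nu a * f (node N nu).

(** The m-th moment of the sum of N independent signs, each equal to 1 with
    weight (1 + a) / 2 and to -1 with weight (1 - a) / 2. *)
Definition signed_moment N a m : R :=
  \sum_(nu < N.+1) weight N nu a * (N%:R - 2 * nu%:R) ^+ m.

(** The j-th moment of one such sign: 1 for j even, a for j odd. *)
Definition sign_moment a j : R := (1 + a) / 2 + (1 - a) / 2 * (-1) ^+ j.

(** Pascal's rule: the last of N + 1 signs is split off. *)
Lemma weight_recursion N a (g : nat -> R) :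
  \sum_(nu < N.+2) weight N.+1 nu a * g nu =
  \sum_(nu < N.+1) weight N nu a *
    ((1 + a) / 2 * g nu + (1 - a) / 2 * g nu.+1).
Proof.
have [p pE] : {p | p = (1 + a) / 2} by exists ((1 + a) / 2).
have [q qE] : {q | q = (1 - a) / 2} by exists ((1 - a) / 2).
rewrite -pE -qE.
under [RHS]eq_bigr do rewrite mulrDr; rewrite big_split /=.
rewrite big_ord_recl /= [X in _ = X + _]big_ord_recl /=.
have -> : weight N.+1 0 a * g 0%N = weight N 0 a * (p * g 0%N).
  rewrite /weight !bin0 !expr0 !subn0 exprS -pE; ring.
rewrite -addrA; congr (_ + _).
under eq_bigr => i _.
  rewrite (_ : weight _ _ _ * _ =
    'C(N, i.+1)%:R * q ^+ i.+1 * p ^+ (N - i) * g i.+1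
    + weight N i a * (q * g i.+1)); last first.
    rewrite /weight /bump /= add1n binS natrD subSS -pE -qE exprS; ring.
  over.
rewrite big_split /=; congr (_ + _).
rewrite big_ord_recr /= bin_small// !mul0r addr0.
apply: eq_bigr => i _; rewrite /weight /bump /= add1n -pE -qE.
have -> : (N - i = (N - i.+1).+1)%N by rewrite subnSK.
by rewrite (exprS p); ring.
Qed.

(** The binomial formula for the power of a sum of two independent variables. *)
Lemma signed_momentS N a m : signed_moment N.+1 a m =
  \sum_(i < m.+1) (signed_moment N a (m - i) * sign_moment a i) *+ 'C(m, i).
Proof.
rewrite /signed_moment (weight_recursion _ _ (fun nu => (N.+1%:R - 2 * nu%:R) ^+ m)).
under [RHS]eq_bigr do rewrite mulr_suml -sumrMnl.
rewrite exchange_big /=; apply: eq_bigr => nu _.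
under [RHS]eq_bigr do rewrite -mulrA -mulrnAr.
rewrite -mulr_sumr; congr (_ * _).
set x := N%:R - 2 * nu%:R.
have -> : N.+1%:R - 2 * nu%:R = x + 1 :> R by rewrite /x -natr1; ring.
have -> : N.+1%:R - 2 * nu.+1%:R = x + (-1) :> R by rewrite /x -!natr1; ring.
rewrite !exprDn !mulr_sumr -big_split /=; apply: eq_bigr => i _.
rewrite expr1n mulr1 !mulrnAr -mulrnDl; congr (_ *+ _).
by rewrite /sign_moment; ring.
Qed.

Lemma sign_moment0 a : sign_moment a 0 = 1.
Proof. by rewrite /sign_moment expr0; field. Qed.

Lemma sign_moment1 a : sign_moment a 1 = a.
Proof. by rewrite /sign_moment expr1; field. Qed.

Lemma sign_moment_le a A j : 1 <= A -> `|a| <= A -> `|sign_moment a j| <= A ^+ j.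
Proof.
move=> A1 aA; rewrite /sign_moment -signr_odd; case oddj : (odd j).
  rewrite expr1 (_ : _ + _ = a); last by field.
  by case: j oddj => // j _; rewrite (le_trans aA)// ler_eXnr.
rewrite expr0 (_ : _ + _ = 1); last by field.
by rewrite normr1 exprn_ege1.
Qed.

Lemma signed_moment0 a m : signed_moment 0 a m = 0 ^+ m.
Proof.
by rewrite /signed_moment big_ord1 /weight bin0 !expr0 mulr0 subr0 !mul1r.
Qed.

(** A product of powers of independent signs has a moment at most A to the total
    degree, and there are N ^ m such products. *)
Lemma signed_moment_le N a A m : 1 <= A -> `|a| <= A ->
  `|signed_moment N a m| <= (N%:R * A) ^+ m.
Proof.
move=> A1 aA; elim: N m => [|N IH] m.
  by rewrite signed_moment0 mul0r normrX normr0.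
rewrite signed_momentS -natr1 mulrDl mul1r exprDn.
apply: (le_trans (ler_norm_sum _ _ _)); apply: ler_sum => i _.
rewrite normrMn lerMn2r; apply/orP; right.
by rewrite normrM ler_pM// sign_moment_le.
Qed.

(** Expand both powers over the maps from m points to N signs. An injective map
    contributes a ^ m to each side; each of the other N ^ m - N ^_ m maps
    contributes at most A ^ m to each side. *)
Lemma signed_moment_sub N a A m : 1 <= A -> `|a| <= A ->
  `|signed_moment N a m - (N%:R * a) ^+ m|
    <= 2 * A ^+ m * (N%:R ^+ m - (N ^_ m)%:R).
Proof.
move=> A1 aA; have A0 : 0 <= A by rewrite (le_trans _ A1).
elim: N m => [|N IH] m.
  rewrite signed_moment0 mul0r subrr normr0; case: m => [|m].
    by rewrite expr0 ffactn0 subrr mulr0.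
  by rewrite expr0n ffact_small// subrr mulr0.
case: m => [|m].
  rewrite signed_momentS big_ord1 sign_moment0 mulr1 bin0 mulr1n.
  by have := IH 0%N; rewrite !expr0 !ffactn0 !subrr.
have N1a : (N.+1%:R * a) ^+ m.+1 = (N%:R * a + a) ^+ m.+1.
  by rewrite -natr1 mulrDl mul1r.
have N1 : N.+1%:R ^+ m.+1 = (N%:R + 1) ^+ m.+1 :> R by rewrite -natr1.
rewrite N1a N1 signed_momentS !exprDn -sumrB.
(* The moments of order 0 and 1 of the last sign are exactly 1 and a, so that
   only the terms of index at least 2 create a new error. *)
rewrite 2![in leLHS]big_ord_recl 2![in leRHS]big_ord_recl /=.
rewrite /bump /= !add1n !subn0 !bin0 !bin1 subn1/= sign_moment0 sign_moment1.
rewrite !expr0 !expr1 !mulr1 !mulr1n.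
have -> : (N.+1 ^_ m.+1)%:R = (N ^_ m.+1)%:R + (N ^_ m)%:R * m.+1%:R :> R.
  rewrite -natrM -natrD; congr (_%:R).
  have [mN|Nm] := leqP m N; last first.
    by rewrite !ffact_small// ltnW// ltnS.
  by rewrite ffactSS ffactnSr -mulnDr addnS subnK// mulnC.
set d0 := signed_moment N a m.+1 - _.
have -> : (signed_moment N a m * a) *+ m.+1 - ((N%:R * a) ^+ m * a) *+ m.+1
  = (signed_moment N a m - (N%:R * a) ^+ m) * a *+ m.+1.
  by rewrite -mulrnBl mulrBl.
set d1 := (_ * a) *+ _; set S := \sum_(i < m) _; set T := \sum_(i < m) _.
apply: (@le_trans _ _ (`|d0| + `|d1| + `|S|)).
  by rewrite addrA (le_trans (ler_normD _ _))// lerD2r ler_normD.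
have h0 : `|d0| <= 2 * A ^+ m.+1 * (N%:R ^+ m.+1 - (N ^_ m.+1)%:R) by exact: IH.
have h1 : `|d1| <= 2 * A ^+ m.+1 * (N%:R ^+ m - (N ^_ m)%:R) *+ m.+1.
  rewrite normrMn lerMn2r; apply/orP; right.
  rewrite normrM exprSr.
  apply: (le_trans (ler_pM _ _ (IH m) aA)) => //; lra.
have h2 : `|S| <= 2 * A ^+ m.+1 * T.
  rewrite (le_trans (ler_norm_sum _ _ _))// mulr_sumr ler_sum// => i _.
  rewrite -mulrnBl normrMn mulrnAr lerMn2r; apply/orP; right.
  rewrite !expr1n mulr1.
  apply: (le_trans (ler_normB _ _)).
  have Am : A ^+ m.+1 = A ^+ (m.+1 - i.+2) * A ^+ i.+2.
    by rewrite -exprD subnK// ltnS.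
  have -> : 2 * A ^+ m.+1 * N%:R ^+ (m.+1 - i.+2) =
      (N%:R * A) ^+ (m.+1 - i.+2) * A ^+ i.+2 +
      (N%:R * A) ^+ (m.+1 - i.+2) * A ^+ i.+2.
    by rewrite Am exprMn; ring.
  apply: lerD.
    by rewrite normrM ler_pM// ?signed_moment_le ?sign_moment_le.
  rewrite [in leLHS]normrM ler_pM//.
    by rewrite normrX normrM normr_nat lerXn2r ?nnegrE ?mulr_ge0 ?ler_wpM2l.
  by rewrite normrX lerXn2r ?nnegrE.
apply: (le_trans (lerD (lerD h0 h1) h2)).
rewrite -(mulr_natr (_ * _)) -(mulr_natr (_ ^+ m)).
move: (m.+1%:R) (A ^+ m.+1) (N%:R ^+ m.+1) (N%:R ^+ m) => x1 x2 x3 x4.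
by move: (_%:R) (_%:R) => x6 x7; rewrite le_eqVlt; apply/orP; left; apply/eqP; ring.
Qed.

(** Among the N ^ (m + 1) maps, those which are not injective are fewer by a factor
    of order N. *)
Lemma leq_expn_ffact N m : (N ^ m.+1 <= N ^_ m.+1 + m ^ 2 * N ^ m)%N.
Proof.
elim: m => [|m IH]; first by rewrite ffactn1 expn1 leq_addr.
rewrite expnSr (leq_trans (leq_mul IH (leqnn _)))//.
rewrite mulnDl (ffactnSr N m.+1) -(mulnA (m ^ 2)%N) -expnSr.
have [Nm|mN] := ltnP N m.+1.
  rewrite ffact_small// !mul0n !add0n leq_mul2r leq_exp2r//; apply/orP; right.
  exact: leqnSn.
have -> : (N ^_ m.+1 * N = N ^_ m.+1 * (N - m.+1) + N ^_ m.+1 * m.+1)%N.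
  by rewrite -mulnDr subnK.
rewrite -addnA leq_add2l.
have ffN : (N ^_ m.+1 <= N ^ m.+1)%N.
  elim: (m.+1) => // k IHk; by rewrite ffactnSr expnSr leq_mul ?leq_subr.
apply: (@leq_trans (N ^ m.+1 * m.+1 + m ^ 2 * N ^ m.+1)%N).
  by rewrite leq_add2r leq_mul2r ffN orbT.
rewrite mulnC -mulnDl leq_mul2r; apply/orP; right.
by rewrite -!mulnn mulSn leq_add2l leq_mul2l leqnSn orbT.
Qed.

Lemma bernstein_expE N a m : (0 < N)%N ->
  bernstein N a (fun x => x ^+ m) = signed_moment N a m / N%:R ^+ m.
Proof.
move=> N0; rewrite mulr_suml; apply: eq_bigr => nu _; rewrite -mulrA.
by rewrite -expr_div_n mulrBl divff// pnatr_eq0 -lt0n.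
Qed.

Lemma bernstein_exp_le N a A m : (0 < N)%N -> 1 <= A -> `|a| <= A ->
  `|bernstein N a (fun x => x ^+ m)| <= A ^+ m.
Proof.
move=> N0 A1 aA; rewrite bernstein_expE// normrM normfV normrX normr_nat.
rewrite ler_pdivrMr ?exprn_gt0 ?ltr0n// mulrC -exprMn.
exact: signed_moment_le.
Qed.

(** The factor m ^ 2 which counts collisions is absorbed in 4 ^ m, so that the error
    can be summed over a power series at the price of a larger radius. *)
Lemma bernstein_exp_sub N a A m : (0 < N)%N -> 1 <= A -> `|a| <= A ->
  `|bernstein N a (fun x => x ^+ m) - a ^+ m| <= (4 * A) ^+ m / N%:R.
Proof.
move=> N0 A1 aA; have NR0 : 0 < N%:R :> R by rewrite ltr0n.
have A0 : 0 <= A by rewrite (le_trans _ A1).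
have -> : bernstein N a (fun x => x ^+ m) - a ^+ m =
    (signed_moment N a m - (N%:R * a) ^+ m) / N%:R ^+ m.
  by rewrite bernstein_expE// exprMn; field; rewrite expf_neq0// gt_eqF.
rewrite normrM normfV [X in _ / X]normrX normr_nat ler_pdivrMr ?exprn_gt0//.
apply: (le_trans (signed_moment_sub _ _ _ _ A1 aA)).
case: m => [|m].
  by rewrite !expr0 ffactn0 subrr mulr0 mul1r mulr1 invr_ge0 ltW.
have -> : (4 * A) ^+ m.+1 / N%:R * N%:R ^+ m.+1 =
    2 * A ^+ m.+1 * (4 ^+ m *+ 2 * N%:R ^+ m).
  rewrite exprMn !(exprS _ m) -mulr_natr; field; exact/lt0r_neq0.
rewrite ler_wpM2l// ?mulr_ge0// ?exprn_ge0// lerBlDl.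
rewrite -(mulr_natr (4 ^+ m)) -!natrX -!natrM -natrD ler_nat.
apply: (leq_trans (leq_expn_ffact N m)); rewrite leq_add2l leq_mul2r.
apply/orP; right; rewrite (@leq_trans (4 ^ m))//; last by rewrite leq_pmulr.
by rewrite -[4%N]/(2 ^ 2)%N expnAC leq_exp2r// ltnW// ltn_expl.
Qed.

End Bernstein.

(** * Power series of three variables with a bounded weighted norm *)

Section Majorant.
Context {R : realType}.
Variable rho : R.
Hypothesis rho_ge0 : 0 <= rho.
Implicit Types (f g : R * R * R -> R) (C D : R).

(** Meant for the power series sum c_ijk x^i y^j z^k with sum |c_ijk| rho^(i+j+k) <= C, but
    described without coefficients: products and compositions are reached by
    induction, and an estimate which survives sums and pointwise limits has only
    to be checked on monomials. *)
Inductive majorized : (R * R * R -> R) -> R -> Prop :=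
| majorized_monomial c i j k C : `|c| * rho ^+ (i + j + k) <= C ->
    majorized (fun v => c * (v.1.1 ^+ i * v.1.2 ^+ j * v.2 ^+ k)) C
| majorizedD f g C D : majorized f C -> majorized g D ->
    majorized (fun v => f v + g v) (C + D)
| majorized_lim (f_ : nat -> R * R * R -> R) f C :
    (forall n, majorized (f_ n) C) ->
    (forall v, f_ n v @[n --> \oo] --> f v) -> majorized f C.

Lemma eq_majorized f g C : f =1 g -> majorized f C -> majorized g C.
Proof. by move=> /funext ->. Qed.

Lemma majorized_ge0 f C : majorized f C -> 0 <= C.
Proof.
elim=> [c i j k {}C|{}f g {}C D _ C0 _ D0|f_ {}f {}C _ /(_ 0%N)//].
  by apply: le_trans; rewrite mulr_ge0// exprn_ge0.
exact: addr_ge0.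
Qed.

Lemma majorized_cst c C : `|c| <= C -> majorized (fun=> c) C.
Proof.
move=> cC; apply: (@eq_majorized (fun v => c * (v.1.1 ^+ 0 * v.1.2 ^+ 0 * v.2 ^+ 0))).
  by move=> v; rewrite !expr0 !mulr1.
by apply: majorized_monomial; rewrite expr0 mulr1.
Qed.

Lemma majorized_le f C D : C <= D -> majorized f C -> majorized f D.
Proof.
move=> CD fC; apply: (@eq_majorized (fun v => f v + 0)).
  by move=> v; rewrite addr0.
(* The slack D - C is charged to the zero monomial. *)
rewrite -(subrKC C D); apply: majorizedD => //.
by apply: majorized_cst; rewrite normr0 subr_ge0.
Qed.

(** A weighted l1 norm of the coefficients is submultiplicative. *)
Lemma majorizedM f g C D : majorized f C -> majorized g D ->
  majorized (fun v => f v * g v) (C * D).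
Proof.
move=> fC; elim: fC g D => {f C}.
- move=> c i j k C cC g D gD; have C0 : 0 <= C.
    by apply: le_trans cC; rewrite mulr_ge0// exprn_ge0.
  elim: gD => {g D}.
  + move=> d i' j' k' D dD; apply: (@eq_majorized
      (fun v => c * d * (v.1.1 ^+ (i + i') * v.1.2 ^+ (j + j') * v.2 ^+ (k + k')))).
      by move=> v; rewrite !exprD; ring.
    apply: majorized_monomial.
    have -> : (i + i' + (j + j') + (k + k') = (i + j + k) + (i' + j' + k'))%N by lia.
    rewrite exprD normrM mulrACA ler_pM// ?mulr_ge0// ?exprn_ge0//.
  + move=> f g C' D' _ IHf _ IHg; rewrite mulrDr.
    by apply: eq_majorized (majorizedD _ _ _ _ IHf IHg) => v /=; rewrite mulrDr.
  + move=> f_ f C' _ IH f_f; apply: (majorized_lim _ _ _ IH) => v.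
    by apply: cvgM; [exact: cvg_cst|exact: f_f].
- move=> f1 f2 C1 C2 _ IH1 _ IH2 g D gD; rewrite mulrDl.
  by apply: eq_majorized (majorizedD _ _ _ _ (IH1 _ _ gD) (IH2 _ _ gD)) => v /=;
    rewrite mulrDl.
- move=> f_ f C _ IH f_f g D gD.
  apply: (majorized_lim _ _ _ (fun n => IH n _ _ gD)) => v.
  by apply: cvgM; [exact: f_f|exact: cvg_cst].
Qed.

Lemma majorizedX f C n : majorized f C -> majorized (fun v => f v ^+ n) (C ^+ n).
Proof.
move=> fC; elim: n => [|n IH].
  by apply: majorized_cst; rewrite normr1.
by rewrite exprS; apply: eq_majorized (majorizedM _ _ _ _ fC IH) => v; rewrite exprS.
Qed.

(** The partial sums of the series defining h, evaluated at f, are dominated by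
    those of the exponential series at C. *)
Lemma majorized_comp (c : nat -> R) (h : R -> R) f C :
  (forall k, `|c k| <= k`!%:R^-1) ->
  (forall y, series (fun k => c k * y ^+ k) @ \oo --> h y) ->
  majorized f C -> majorized (fun v => h (f v)) (expR C).
Proof.
move=> c_le ch fC; have C0 := majorized_ge0 _ _ fC.
apply: (majorized_lim (fun n v => series (fun k => c k * f v ^+ k) n)); last first.
  by move=> v; exact: ch.
move=> n; apply: (@majorized_le _ (series (exp_coeff C) n)).
  apply: nondecreasing_cvgn_le (is_cvg_series_exp_coeff C) n.
  apply: nondecreasing_series => k _ _.
  by rewrite /exp_coeff/= divr_ge0 ?exprn_ge0.
rewrite /series/=; elim: n => [|n IH].
  rewrite big_nil; apply: (@eq_majorized (fun=> 0)); last first.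
    by apply: majorized_cst; rewrite normr0.
  by move=> v; rewrite big_nil.
rewrite big_nat_recr//=; apply: (@eq_majorized (fun v =>
    (\sum_(0 <= k < n) c k * f v ^+ k) + c n * f v ^+ n)).
  by move=> v; rewrite big_nat_recr.
apply: majorizedD => //; rewrite /exp_coeff/= mulrC.
by apply: majorizedM; [exact: majorized_cst|exact: majorizedX].
Qed.

Lemma majorized_expR f C : majorized f C -> majorized (fun v => expR (f v)) (expR C).
Proof.
apply: (majorized_comp (fun k => k`!%:R^-1)) => [k|y].
  by rewrite ger0_norm ?invr_ge0.
rewrite (_ : (fun _ => _) = exp_coeff y).
  exact: is_cvg_series_exp_coeff.
by apply/funext => k; rewrite /exp_coeff/= mulrC.
Qed.

Lemma majorized_cos f C : majorized f C -> majorized (fun v => cos (f v)) (expR C).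
Proof.
apply: (majorized_comp (fun n => (~~ odd n)%:R * (-1) ^+ n./2 * (n`!%:R)^-1)) => [k|y].
  rewrite normrM normrM normrX normrN1 expr1n mulr1.
  rewrite [X in _ * X]ger0_norm ?invr_ge0// ler_piMl ?invr_ge0//.
  by case: odd; rewrite /= ?normr0 ?normr1.
rewrite -cos_coeffE unlock; exact: is_cvg_series_cos_coeff.
Qed.

Lemma majorized_sin f C : majorized f C -> majorized (fun v => sin (f v)) (expR C).
Proof.
apply: (majorized_comp (fun n => (odd n)%:R * (-1) ^+ n.-1./2 * (n`!%:R)^-1)) => [k|y].
  rewrite normrM normrM normrX normrN1 expr1n mulr1.
  rewrite [X in _ * X]ger0_norm ?invr_ge0// ler_piMl ?invr_ge0//.
  by case: odd; rewrite /= ?normr0 ?normr1.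
rewrite -sin_coeffE unlock; exact: is_cvg_series_sin_coeff.
Qed.

End Majorant.

Section Bernstein3.
Context {R : realType}.
Implicit Types (N : nat * nat * nat) (v : R * R * R) (f : R * R * R -> R).

Definition bernstein3 N v f : R :=
  \sum_(nu1 < N.1.1.+1) \sum_(nu2 < N.1.2.+1) \sum_(nu3 < N.2.+1)
    weight N.1.1 nu1 v.1.1 * weight N.1.2 nu2 v.1.2 * weight N.2 nu3 v.2 *
    f (node N.1.1 nu1, node N.1.2 nu2, node N.2 nu3).

Definition inv_sum N : R := N.1.1%:R^-1 + N.1.2%:R^-1 + N.2%:R^-1.

Lemma bernstein3_monomial N v c i j k :
  bernstein3 N v (fun u => c * (u.1.1 ^+ i * u.1.2 ^+ j * u.2 ^+ k)) =
  c * (bernstein N.1.1 v.1.1 (fun x => x ^+ i) * bernstein N.1.2 v.1.2 (fun x => x ^+ j)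
       * bernstein N.2 v.2 (fun x => x ^+ k)).
Proof.
rewrite /bernstein3 /bernstein /= -[X in c * X]mulrA mulr_suml mulr_sumr.
apply: eq_bigr => n1 _; rewrite mulr_suml 2!mulr_sumr.
apply: eq_bigr => n2 _; rewrite 3!mulr_sumr.
by apply: eq_bigr => n3 _; ring.
Qed.

Lemma bernstein3D N v f g :
  bernstein3 N v (fun u => f u + g u) = bernstein3 N v f + bernstein3 N v g.
Proof.
rewrite /bernstein3 -big_split; apply: eq_bigr => n1 _ /=.
rewrite -big_split; apply: eq_bigr => n2 _ /=.
by rewrite -big_split; apply: eq_bigr => n3 _ /=; rewrite mulrDr.
Qed.

Lemma cvg_bernstein3 N v (f_ : nat -> R * R * R -> R) f :
  (forall u, f_ n u @[n --> \oo] --> f u) ->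
  bernstein3 N v (f_ n) @[n --> \oo] --> bernstein3 N v f.
Proof.
move=> f_f; do 3 (apply: cvg_big => [|? _]; first exact: add_continuous).
by apply: cvgM; [exact: cvg_cst|exact: f_f].
Qed.

(** For a monomial the product of the three one-dimensional operators is compared
    with the product of the powers one factor at a time. Limits are harmless
    because N is fixed and bernstein3 reads f at finitely many points. *)
Lemma bernstein3_sub N v f A C : 1 <= A ->
  `|v.1.1| <= A -> `|v.1.2| <= A -> `|v.2| <= A ->
  (0 < N.1.1)%N -> (0 < N.1.2)%N -> (0 < N.2)%N ->
  majorized (4 * A) f C -> `|bernstein3 N v f - f v| <= C * inv_sum N.
Proof.
move=> A1 v1 v2 v3 N1 N2 N3 fC; have A0 : 0 <= A by rewrite (le_trans _ A1).
have s0 : 0 <= inv_sum N by rewrite !addr_ge0.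
have A4 : A <= 4 * A by rewrite ler_peMl//; lra.
have rho0 : 0 <= 4 * A by rewrite (le_trans A0).
elim: fC => {f C}.
- move=> c i j k C cC; rewrite bernstein3_monomial -mulrBr normrM.
  apply: le_trans (ler_wpM2r s0 cC); rewrite -[leRHS]mulrA ler_wpM2l//.
  have := bernstein_exp_sub _ _ _ i N1 A1 v1.
  have := bernstein_exp_sub _ _ _ j N2 A1 v2.
  have := bernstein_exp_sub _ _ _ k N3 A1 v3.
  have := bernstein_exp_le _ _ _ i N1 A1 v1.
  have := bernstein_exp_le _ _ _ j N2 A1 v2.
  have lift x m : `|x : R| <= A ^+ m -> `|x| <= (4 * A) ^+ m.
    by move=> /le_trans; apply; rewrite lerXn2r ?nnegrE.
  have vX x m : `|x| <= A -> `|x ^+ m| <= (4 * A) ^+ m.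
    by move=> xA; apply: lift; rewrite normrX lerXn2r ?nnegrE.
  have := vX _ j v2; have := vX _ k v3.
  move: (bernstein N.1.1 _ _) (bernstein N.1.2 _ _) (bernstein N.2 _ _) => b1 b2 b3.
  move=> v3k v2j /lift b2j /lift b1i d3 d2 d1.
  have -> : b1 * b2 * b3 - v.1.1 ^+ i * v.1.2 ^+ j * v.2 ^+ k =
    (b1 - v.1.1 ^+ i) * (v.1.2 ^+ j * v.2 ^+ k) + (b2 - v.1.2 ^+ j) * (b1 * v.2 ^+ k)
    + (b3 - v.2 ^+ k) * (b1 * b2) by ring.
  have -> : (4 * A) ^+ (i + j + k) * inv_sum N =
     (4 * A) ^+ i / N.1.1%:R * ((4 * A) ^+ j * (4 * A) ^+ k) +
     (4 * A) ^+ j / N.1.2%:R * ((4 * A) ^+ i * (4 * A) ^+ k) +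
     (4 * A) ^+ k / N.2%:R * ((4 * A) ^+ i * (4 * A) ^+ j).
    rewrite /inv_sum !exprD.
    move: (N.1.1%:R^-1) (N.1.2%:R^-1) (N.2%:R^-1) => n1 n2 n3.
    by move: ((4 * A) ^+ i) ((4 * A) ^+ j) ((4 * A) ^+ k) => x y z; ring.
  apply: (le_trans (ler_normD _ _)); apply: lerD; last first.
    by rewrite !normrM !ler_pM// mulr_ge0.
  apply: (le_trans (ler_normD _ _)); apply: lerD.
    by rewrite !normrM !ler_pM// mulr_ge0.
  by rewrite !normrM !ler_pM// mulr_ge0.
- move=> f g C D _ IHf _ IHg; rewrite bernstein3D mulrDl opprD addrACA.
  by rewrite (le_trans (ler_normD _ _))// lerD.
- move=> f_ f C _ IH f_f.
  have cvgn : `|bernstein3 N v (f_ n) - f_ n v| @[n --> \oo] --> `|bernstein3 N v f - f v|.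
    by apply: cvg_norm; apply: cvgB; [exact: cvg_bernstein3|exact: f_f].
  rewrite -(cvg_lim _ cvgn)//; apply: limr_le; first by apply/cvg_ex; eexists; exact: cvgn.
  by apply: nearW => n; exact: IH.
Qed.

End Bernstein3.

(** * Fresnel integrals *)

Section Fresnel.
Context {R : realType}.
Local Notation mu := (@lebesgue_measure R).
Implicit Types (f F : R -> R) (p q r phi : R).

Lemma within_continuous_integrable f p q :
  {in `[p, q], continuous f} -> mu.-integrable `[p, q] (EFin \o f).
Proof.
move=> cf; apply: continuous_compact_integrable; first exact: segment_compact.
by apply: continuous_in_subspaceT => x /set_mem; exact: cf.
Qed.

Lemma Rintegral_FTC2 f F p q : p <= q ->
  {in `[p, q], continuous f} -> (forall x, x \in `[p, q] -> is_derive x 1 F (f x)) ->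
  \int[mu]_(x in `[p, q]) f x = F q - F p.
Proof.
rewrite le_eqVlt => /predU1P[->|pq] cf dF.
  by rewrite set_itv1 Rintegral_set1 subrr.
have cF x : x \in `[p, q] -> {for x, continuous F}.
  move=> /dF dFx; apply: differentiable_continuous.
  by apply/derivable1_diffP; apply: ex_derive.
rewrite /Rintegral (@continuous_FTC2 _ f F)//.
- by apply: continuous_in_subspaceT => x /set_mem; exact: cf.
- split.
  + move=> x /subset_itv_oo_cc xpq; have ? := dF _ xpq; exact: ex_derive.
  + by apply: cvg_at_right_filter; apply: cF; rewrite in_itv/= lexx ltW.
  + by apply: cvg_at_left_filter; apply: cF; rewrite in_itv/= lexx ltW.
- move=> x /subset_itv_oo_cc xpq; rewrite derive1E; have := dF _ xpq.
  by move=> ?; exact: derive_val.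
Qed.

Lemma Rintegral_chasles f p q r : p <= q <= r -> continuous f ->
  \int[mu]_(x in `[p, r]) f x =
  \int[mu]_(x in `[p, q]) f x + \int[mu]_(x in `[q, r]) f x.
Proof.
move=> /andP[pq qr] cf.
have fi u v : mu.-integrable `[u, v] (EFin \o f).
  by apply: within_continuous_integrable => x _; exact: cf.
rewrite -(@Rintegral_itv_obnd_cbnd _ q); last first.
  by apply: integrableS (fi q r) => //; exact: subset_itv_oc_cc.
by rewrite -(@Rintegral_itvB _ _ (BLeft p) (BRight r) q)// addrC subrK.
Qed.

Lemma Rintegral_affine f (m r a b : R) : 0 < r -> a <= b -> continuous f ->
  \int[mu]_(y in `[a, b]) f ((y - m) / r) =
  r * \int[mu]_(s in `[(a - m) / r, (b - m) / r]) f s.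
Proof.
move=> r0 ab cf; pose G (y : R) : R := (y - m) / r.
have dG (y : R) : is_derive y (1 : R) G r^-1.
  rewrite /G; apply: is_derive_eq; rewrite scaler0 add0r subr0.
  by rewrite /GRing.scale/= mulr1.
have dGE : derive1 G = cst r^-1.
  by apply/funext => y; rewrite derive1E; exact: derive_val.
have cG (y : R) : {for y, continuous G}.
  apply: differentiable_continuous; apply/derivable1_diffP; exact: ex_derive.
rewrite [in RHS]/Rintegral.
rewrite (@integration_by_substitution_increasing _ G f a b)//.
- rewrite dGE /Rintegral; under [in RHS]eq_integral do rewrite /= mulrC EFinM.
  rewrite integralZl//; last first.
    apply: within_continuous_integrable => x _.
    by apply: continuous_comp; [exact: cG|exact: cf].
  rewrite fineM//; last first.
    apply: integrable_fin_num => //.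
    apply: within_continuous_integrable => x _.
    by apply: continuous_comp; [exact: cG|exact: cf].
  by rewrite mulrA divff ?mul1r// gt_eqF.
- by move=> x y _ _ xy; rewrite /G ltr_pM2r ?invr_gt0// ltrD2r.
- by rewrite dGE => x _; exact: cvg_cst.
- by rewrite dGE; exact: is_cvg_cst.
- by rewrite dGE; exact: is_cvg_cst.
- split.
  + by move=> x _; exact: ex_derive.
  + by apply: cvg_at_right_filter; exact: cG.
  + by apply: cvg_at_left_filter; exact: cG.
- by apply: continuous_subspaceT.
Qed.

(** The phase phi treats cos (s ^ 2) and sin (s ^ 2) = cos (s ^ 2 - pi / 2) at
    the same time. *)
Definition fresnel phi p q : R := \int[mu]_(s in `[p, q]) cos (s ^+ 2 + phi).

Lemma continuous_cos_sqr phi : continuous (fun s : R => cos (s ^+ 2 + phi)).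
Proof.
move=> s; apply: continuous_comp; last exact: continuous_cos.
by apply: cvgD; [exact: exprn_continuous|exact: cvg_cst].
Qed.

Lemma fresnel_chasles phi p q r : p <= q <= r ->
  fresnel phi p r = fresnel phi p q + fresnel phi q r.
Proof. by move=> pqr; apply: Rintegral_chasles => //; exact: continuous_cos_sqr. Qed.

(** Integration by parts of (2 s cos (s ^ 2 + phi)) / (2 s). The free constant e
    gives a sign to the remainder: it is nonnegative for e = 1 and nonpositive
    for e = -1. *)
Lemma fresnel_primitive phi (e s : R) : s != 0 ->
  is_derive s 1 (fun x : R => (sin (x ^+ 2 + phi) - e) * (2 * x)^-1)
    (cos (s ^+ 2 + phi) + (e - sin (s ^+ 2 + phi)) / (2 * s ^+ 2)).
Proof.
move=> s0; have s20 : 2 * s != 0 by rewrite mulf_neq0.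
have s20' := is_deriveV s20.
apply: is_derive_eq.
rewrite /GRing.scale/=.
by field.
Qed.

(** The two primitives above, for e = 1 and e = -1, have derivatives which enclose
    the integrand, so that the integral lies between two boundary terms. *)
Lemma fresnel_tail phi M p q : 0 < M -> p <= q -> M <= p \/ q <= - M ->
  `|fresnel phi p q| <= M^-1.
Proof.
move=> M0 pq Mpq.
have nz s : s \in `[p, q] -> s != 0.
  rewrite in_itv/= => /andP[ps sq]; case: Mpq => [Mp|qM].
    by rewrite gt_eqF// (lt_le_trans M0)// (le_trans Mp).
  by rewrite lt_eqF// (le_lt_trans sq)// (le_lt_trans qM)// oppr_lt0.
have p0 : p != 0 by apply: nz; rewrite in_itv/= lexx.
have q0 : q != 0 by apply: nz; rewrite in_itv/= lexx pq.
pose g e s := cos (s ^+ 2 + phi) + (e - sin (s ^+ 2 + phi)) / (2 * s ^+ 2).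
have cg e : {in `[p, q], continuous (g e)}.
  move=> s /nz s0; apply: cvgD; first exact: continuous_cos_sqr.
  apply: cvgM.
    apply: cvgB; first exact: cvg_cst.
    apply: continuous_comp; last exact: continuous_sin.
    by apply: cvgD; [exact: exprn_continuous|exact: cvg_cst].
  apply: cvgV; first by rewrite mulf_neq0// expf_neq0.
  by apply: cvgM; [exact: cvg_cst|exact: exprn_continuous].
have ig e := within_continuous_integrable _ _ _ (cg e).
have IE e : \int[mu]_(s in `[p, q]) g e s =
   (sin (q ^+ 2 + phi) - e) * (2 * q)^-1 - (sin (p ^+ 2 + phi) - e) * (2 * p)^-1.
  apply: (@Rintegral_FTC2 (g e) (fun x : R => (sin (x ^+ 2 + phi) - e) * (2 * x)^-1)) => // s /nz s0; exact: fresnel_primitive.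
have ic : mu.-integrable `[p, q] (EFin \o (fun s => cos (s ^+ 2 + phi))).
  by apply: within_continuous_integrable => s _; exact: continuous_cos_sqr.
have le1 : fresnel phi p q <= \int[mu]_(s in `[p, q]) g 1 s.
  apply: le_Rintegral => // s _.
  rewrite /g lerDl divr_ge0//.
  by rewrite mulr_ge0// sqr_ge0.
have leN1 : \int[mu]_(s in `[p, q]) g (-1) s <= fresnel phi p q.
  apply: le_Rintegral => // s _.
  rewrite /g gerDl mulr_le0_ge0//.
  by rewrite invr_ge0 mulr_ge0// sqr_ge0.
rewrite !IE in le1 leN1.
have := sin_le1 (p ^+ 2 + phi); have := sin_geN1 (p ^+ 2 + phi).
have := sin_le1 (q ^+ 2 + phi); have := sin_geN1 (q ^+ 2 + phi).
move: (sin _) (sin _) le1 leN1 => sq sp le1 leN1 sq1 sq2 sp1 sp2.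
have inv2 (x : R) : (2 * x)^-1 = x^-1 / 2 by rewrite invfM mulrC.
rewrite !inv2 in le1 leN1.
rewrite ler_norml; case: Mpq => [Mp|qM].
  have pi0 : 0 < p^-1 by rewrite invr_gt0 (lt_le_trans M0).
  have qi0 : 0 < q^-1 by rewrite invr_gt0 (lt_le_trans M0)// (le_trans Mp).
  have pM : p^-1 <= M^-1 by rewrite lef_pV2// posrE (lt_le_trans M0).
  apply/andP; split; nra.
have qi0 : q^-1 < 0 by rewrite invr_lt0; lra.
have pi0 : p^-1 < 0 by rewrite invr_lt0; lra.
have qM' : - M^-1 <= q^-1.
  by rewrite -invrN lef_nV2// negrE; lra.
apply/andP; split; nra.
Qed.

Lemma fresnel_diff phi (M : R) p q : 0 < M -> p <= - M -> M <= q ->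
  `|fresnel phi p q - fresnel phi (- M) M| <= 2 / M.
Proof.
move=> M0 pM Mq; rewrite (@fresnel_chasles _ p (- M)); last first.
  by rewrite pM; lra.
rewrite (@fresnel_chasles _ (- M) M); last by rewrite Mq andbT; lra.
rewrite (_ : _ - _ = fresnel phi p (- M) + fresnel phi M q); last by ring.
rewrite (le_trans (ler_normD _ _))// mulr_natl mulr2n lerD//.
  by apply: fresnel_tail => //; right.
by apply: fresnel_tail => //; left.
Qed.

(** The rate is explicit because it is used with end points p and q depending on
    the frequency. *)
Lemma fresnel_cvg phi : exists c, forall M p q, 0 < M -> p <= - M -> M <= q ->
  `|fresnel phi p q - c| <= 4 / M.
Proof.
pose u n := fresnel phi (- n.+1%:R) n.+1%:R.
have un M n : 0 < M -> M <= n.+1%:R -> `|u n - fresnel phi (- M) M| <= 2 / M.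
  by move=> M0 Mn; apply: fresnel_diff => //; rewrite lerN2.
have /cvg_ex[c uc] : cvg (u @ \oo).
  apply/cauchy_cvgP/cauchy_exP => e e0.
  have [n _ Hn] := near_infty_natSinv_lt (PosNum (divr_gt0 e0 (ltr0n R 2))).
  exists (u n), n => // m /= nm; rewrite /ball/= distrC.
  rewrite (le_lt_trans (un n.+1%:R m _ _))// ?ler_nat//.
  by have /= := Hn n (leqnn _); rewrite ltr_pdivlMr// mulrC.
exists c => M p q M0 pM Mq.
have cM : `|c - fresnel phi (- M) M| <= 2 / M.
  have cvu : `|u n - fresnel phi (- M) M| @[n --> \oo] --> `|c - fresnel phi (- M) M|.
    by apply: cvg_norm; apply: cvgB => //; exact: cvg_cst.
  rewrite -(cvg_lim _ cvu)//; apply: limr_le; first by apply/cvg_ex; eexists; exact: cvu.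
  exists (Num.truncn M) => // n /= Mn; apply: un => //.
  by rewrite ltW// (lt_le_trans (truncnS_gt _))// ler_nat.
have -> : fresnel phi p q - c =
  (fresnel phi p q - fresnel phi (- M) M) - (c - fresnel phi (- M) M) by ring.
rewrite (le_trans (ler_normB _ _))// (_ : 4 / M = 2 / M + 2 / M); last by field; lra.
by rewrite lerD// fresnel_diff.
Qed.

End Fresnel.

(** * Exchanging a spectral integral with an integral over a segment *)

Section RealFubini.
Context {R : realType}.
Local Notation mu := (@lebesgue_measure R).

Lemma integrable_mul_bounded (p h : R -> R) (M : R) :
  mu.-integrable setT (EFin \o p) -> measurable_fun setT h ->
  (forall x, `|h x| <= M) -> mu.-integrable setT (EFin \o (fun x => p x * h x)).
Proof.
move=> ip mh hM; have := @integrableMr _ _ _ mu _ measurableT h (EFin \o p).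
move=> /(_ mh); rewrite (_ : (_ \* _)%E = EFin \o (fun x => p x * h x)); last first.
  by apply/funext => x /=; rewrite EFinM muleC.
apply => //; exists M; split; first exact: num_real.
by move=> y My x _; exact: le_trans (hM x) (ltW My).
Qed.

Context (p : R -> R) (h : R * R -> R) (M a b : R).
Hypothesis ip : mu.-integrable setT (EFin \o p).
Hypothesis mh : measurable_fun [set: R * R] h.
Hypothesis hM : forall z, `|h z| <= M.

(** The indicator function turns the integral over [a, b] into one over the line,
    so that both variables range over the same measure space. *)
Let f (z : R * R) : \bar R := (p z.1 * (h z * \1_(`[a, b]%classic) z.2))%:E.

Let M0 : 0 <= M. Proof. exact: le_trans (hM (0, 0)). Qed.

Let mp : measurable_fun setT p.
Proof. by apply/measurable_EFinP; exact: measurable_int ip. Qed.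

Let mh1 x : measurable_fun setT (fun y => h (x, y)).
Proof. exact: measurableT_comp mh (measurable_pair1 x). Qed.

Let mh2 y : measurable_fun setT (fun x => h (x, y)).
Proof. exact: measurableT_comp mh (measurable_pair2 y). Qed.

Let f_integrable : (mu \x mu)%E.-integrable setT f.
Proof.
have mf : measurable_fun setT f.
  apply/measurable_EFinP; apply: measurable_funM.
    exact: measurableT_comp mp measurable_fst.
  apply: measurable_funM => //.
  exact: (measurableT_comp (measurable_indic _)) measurable_snd.
apply/integrable12ltyP => //.
pose L : R := fine (mu `[a, b]).
have LE : (L%:E = mu `[a, b])%E.
  rewrite /L fineK// ge0_fin_numE//; apply: compact_finite_measure.
  exact: segment_compact.
apply: (@le_lt_trans _ _ (\int[mu]_x (`|(p x * (M * L))%:E|))%E); last first.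
  have : mu.-integrable setT (EFin \o (fun x => p x * (M * L))).
    exact: (@integrable_mul_bounded p (fun=> M * L) `|M * L|).
  by case/integrableP.
apply: ge0_le_integral => //.
- by move=> x _; exact: integral_ge0.
- apply: (measurable_fun_fubini_tonelli_F (m2 := mu) (abse \o f)) => /=.
    exact: measurableT_comp.
  by move=> x; rewrite lee_fin.
- by apply: measurableT_comp => //; apply/measurable_EFinP; exact: measurable_funM.
move=> x _.
apply: (@le_trans _ _ (\int[mu]_y ((`|p x| * M)%:E * (\1_(`[a, b]%classic) y)%:E))%E).
  have mfx : measurable_fun setT (fun y => f (x, y)).
    exact: measurableT_comp mf (measurable_pair1 x).
  apply: ge0_le_integral => //.
  - by apply: measurableT_comp => //; exact: mfx.
  - by apply/measurable_EFinP; apply: measurable_funM.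
  move=> y _; rewrite /f /= -EFinM lee_fin normrM -mulrA ler_wpM2l//.
  by rewrite normrM ler_pM// ger0_norm.
rewrite ge0_integralZl//; [|exact/measurable_EFinP|by rewrite lee_fin mulr_ge0].
rewrite integral_indic// setIT -[X in (_ * X)%E]LE -EFinM.
by rewrite lee_fin normrM -mulrA ler_wpM2l// ler_norm.
Qed.

Let bounded_on_itv x : mu.-integrable `[a, b] (fun y => (h (x, y))%:E).
Proof.
apply: measurable_bounded_integrable => //.
- by apply: compact_finite_measure; exact: segment_compact.
- by apply: measurable_funTS; exact: mh1.
- by exists M; split=> [|y My z _]; [exact: num_real|exact: le_trans (hM _) (ltW My)].
Qed.

Let inner_y x : (\int[mu]_y f (x, y) = (p x * \int[mu]_(y in `[a, b]) h (x, y))%:E)%E.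
Proof.
rewrite /Rintegral EFinM fineK; last first.
  by apply: integrable_fin_num.
rewrite -integralZl// [RHS]integral_mkcond; apply: eq_integral => y _.
by rewrite /f/= patchE indicE; case: ifP => _; rewrite ?mulr1 ?mulr0// EFinM.
Qed.

Let inner_x y : (\int[mu]_x f (x, y) =
  ((fun y => (\int[mu]_x (p x * h (x, y)))%:E) \_ `[a, b]) y)%E.
Proof.
rewrite patchE /f/= indicE; case: ifP => _; last first.
  by under eq_integral do rewrite !mulr0; rewrite integral0.
under eq_integral do rewrite mulr1.
rewrite /Rintegral fineK//; apply: integrable_fin_num => //.
exact: (integrable_mul_bounded _ _ M).
Qed.

Lemma integrable_fubini_itv :
  mu.-integrable `[a, b] (fun y => (\int[mu]_x (p x * h (x, y)))%:E).
Proof.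
apply: measurable_bounded_integrable => //.
- by apply: compact_finite_measure; exact: segment_compact.
- apply/measurable_EFinP.
  apply: (@eq_measurable_fun _ _ _ _ _ (fun y => \int[mu]_x f (x, y))%E).
    by move=> y yab; rewrite inner_x patchE yab.
  apply: measurable_funTS; exact: measurable_fubini_G f_integrable.
- exists (\int[mu]_x (`|p x| * M)); split=> [|B MB y _]; first exact: num_real.
  have ipM : mu.-integrable setT (EFin \o (fun x => `|p x| * M)).
    apply: (@integrable_mul_bounded _ (fun=> M) `|M|) => //.
    exact: integrable_norm.
  have iph : mu.-integrable setT (EFin \o (fun x => p x * h (x, y))).
    exact: (integrable_mul_bounded _ _ M).
  suff gM : `|\int[mu]_x (p x * h (x, y))| <= \int[mu]_x (`|p x| * M).
    exact: le_trans gM (ltW MB).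
  apply: (le_trans (le_normr_Rintegral _ iph)) => //.
  apply: le_Rintegral => //; first exact: (integrable_norm iph).
  by move=> x _; rewrite normrM ler_wpM2l.
Qed.

Lemma integrable_fubini_T :
  mu.-integrable setT (fun x => (p x * \int[mu]_(y in `[a, b]) h (x, y))%:E).
Proof.
apply: eq_integrable (integrable_fubini_F f_integrable) => //.
by move=> x _; exact: inner_y.
Qed.

Lemma Rintegral_fubini_itv :
  \int[mu]_(y in `[a, b]) \int[mu]_x (p x * h (x, y)) =
  \int[mu]_x (p x * \int[mu]_(y in `[a, b]) h (x, y)).
Proof.
rewrite [LHS]/Rintegral [RHS]/Rintegral; congr fine.
rewrite integral_mkcond.
under eq_integral do rewrite -inner_x.
by rewrite -(Fubini f_integrable); apply: eq_integral => x _; rewrite inner_y.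
Qed.

End RealFubini.

(** * Integrals of complex functions *)

Section ComplexIntegral.
Context {R : realType}.
Local Notation mu := (@lebesgue_measure R).
Local Notation Re := (@complex.Re R).
Local Notation Im := (@complex.Im R).
Implicit Types (D : set R) (f g h P : R -> R[i]) (c : R[i]).

Lemma Re_mulc (x y : R[i]) : Re (x * y) = Re x * Re y - Im x * Im y.
Proof. by case: x y => [? ?] []. Qed.

Lemma Im_mulc (x y : R[i]) : Im (x * y) = Re x * Im y + Im x * Re y.
Proof. by case: x y => [? ?] []. Qed.

Lemma Re_addc (x y : R[i]) : Re (x + y) = Re x + Re y.
Proof. by case: x y => [? ?] []. Qed.

Lemma Im_addc (x y : R[i]) : Im (x + y) = Im x + Im y.
Proof. by case: x y => [? ?] []. Qed.

Lemma complex_ext (x y : R[i]) : Re x = Re y -> Im x = Im y -> x = y.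
Proof. by case: x y => [? ?] [? ?] /= -> ->. Qed.

Lemma expiD (x y : R) : expi (x + y) = expi x * expi y.
Proof. by apply: complex_ext; rewrite ?Re_mulc ?Im_mulc /= ?cosD ?sinD// addrC. Qed.

Lemma normc_le (z : R[i]) (e : R) : `|Re z| <= e -> `|Im z| <= e ->
  `|z| <= (2 * e)%:C.
Proof.
move=> Re_e Im_e; have e0 : 0 <= e by exact: le_trans Re_e.
rewrite normc_def lecR -(ger0_norm (mulr_ge0 (ler0n R 2) e0)) -sqrtr_sqr.
rewrite ler_wsqrtr// -(real_normK (num_real (Re z))) -(real_normK (num_real (Im z))).
have := lerXn2r 2 (normr_ge0 _) e0 Re_e.
have := lerXn2r 2 (normr_ge0 _) e0 Im_e; rewrite exprMn; nra.
Qed.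

Lemma eq_complex_integral D f g : f =1 g ->
  complex_integral D f = complex_integral D g.
Proof. by move=> /funext ->. Qed.

(** The ascription of the type of D selects the sigma-algebra on which the Lebesgue
    measure is defined. *)
Lemma complex_integrableD D f g : measurable (D : set (measurableTypeR R)) ->
  complex_integrable D f -> complex_integrable D g ->
  complex_integrable D (fun x => f x + g x).
Proof.
move=> mD [fr fi] [gr gi]; split.
  apply: (eq_integrable mD _ _ _ (integrableD mD fr gr)) => // x _ /=; by rewrite Re_addc EFinD.
apply: (eq_integrable mD _ _ _ (integrableD mD fi gi)) => // x _ /=; by rewrite Im_addc EFinD.
Qed.

Lemma complex_integralD D f g : measurable (D : set (measurableTypeR R)) ->
  complex_integrable D f -> complex_integrable D g ->
  complex_integral D (fun x => f x + g x) = complex_integral D f + complex_integral D g.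
Proof.
move=> mD [fr fi] [gr gi]; apply: complex_ext; rewrite ?Re_addc ?Im_addc /=.
  by under eq_Rintegral do rewrite Re_addc; rewrite RintegralD.
by under eq_Rintegral do rewrite Im_addc; rewrite RintegralD.
Qed.

Lemma integrableZlR D (r : R) (f : R -> R) : measurable (D : set (measurableTypeR R)) ->
  mu.-integrable D (EFin \o f) -> mu.-integrable D (EFin \o (fun x => r * f x)).
Proof.
move=> mD fi; apply: (eq_integrable mD _ _ _ (integrableZl mD r fi)) => // x _ /=.
Qed.

Lemma complex_integrableZl D c f : measurable (D : set (measurableTypeR R)) ->
  complex_integrable D f -> complex_integrable D (fun x => c * f x).
Proof.
move=> mD [fr fi]; split.
  apply: (eq_integrable mD _ _ _ (integrableB mD (integrableZlR _ (Re c) _ mD fr)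
    (integrableZlR _ (Im c) _ mD fi))) => // x _ /=.
  by rewrite Re_mulc EFinB.
apply: (eq_integrable mD _ _ _ (integrableD mD (integrableZlR _ (Re c) _ mD fi)
  (integrableZlR _ (Im c) _ mD fr))) => // x _ /=.
by rewrite Im_mulc EFinD.
Qed.

Lemma complex_integralZl D c f : measurable (D : set (measurableTypeR R)) -> complex_integrable D f ->
  complex_integral D (fun x => c * f x) = c * complex_integral D f.
Proof.
move=> mD [fr fi]; apply: complex_ext; rewrite ?Re_mulc ?Im_mulc /=.
  under eq_Rintegral do rewrite Re_mulc.
  by rewrite RintegralB ?RintegralZl//; exact: integrableZlR.
under eq_Rintegral do rewrite Im_mulc.
by rewrite RintegralD ?RintegralZl//; exact: integrableZlR.
Qed.

Lemma complex_integralB D f g : measurable (D : set (measurableTypeR R)) ->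
  complex_integrable D f -> complex_integrable D g ->
  complex_integral D f - complex_integral D g = complex_integral D (fun x => f x - g x).
Proof.
move=> mD fi gi; rewrite -mulN1r -complex_integralZl// -complex_integralD//.
  by apply: eq_complex_integral => x; rewrite mulN1r.
exact: complex_integrableZl.
Qed.

Lemma complex_integrableB D f g : measurable (D : set (measurableTypeR R)) ->
  complex_integrable D f -> complex_integrable D g ->
  complex_integrable D (fun x => f x - g x).
Proof.
move=> mD fi gi; rewrite (_ : (fun x => _) = (fun x => f x + -1 * g x)).
  by apply: complex_integrableD => //; exact: complex_integrableZl.
by apply/funext => x; rewrite mulN1r.
Qed.

Lemma complex_integrable0 D : complex_integrable D (fun=> 0).
Proof. by split; exact: integrable0. Qed.

Lemma complex_integral0 D : complex_integral D (fun=> 0) = 0.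
Proof. by apply: complex_ext; rewrite /= /Rintegral integral0. Qed.

Lemma complex_integrable_sum D (I : Type) (s : seq I) (F : I -> R -> R[i]) :
  measurable (D : set (measurableTypeR R)) -> (forall i, complex_integrable D (F i)) ->
  complex_integrable D (fun x => \sum_(i <- s) F i x).
Proof.
move=> mD iF; elim: s => [|i s IH].
  by under eq_fun do rewrite big_nil; exact: complex_integrable0.
by under eq_fun do rewrite big_cons; exact: complex_integrableD.
Qed.

Lemma complex_integral_sum D (I : Type) (s : seq I) (F : I -> R -> R[i]) :
  measurable (D : set (measurableTypeR R)) -> (forall i, complex_integrable D (F i)) ->
  complex_integral D (fun x => \sum_(i <- s) F i x) =
  \sum_(i <- s) complex_integral D (F i).
Proof.
move=> mD iF; elim: s => [|i s IH].
  by under eq_fun do rewrite big_nil; rewrite big_nil complex_integral0.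
under eq_fun do rewrite big_cons; rewrite big_cons complex_integralD ?IH//.
exact: complex_integrable_sum.
Qed.

Lemma complex_integrable_mul P h (M : R) : complex_integrable setT P ->
  measurable_fun setT (Re \o h) -> measurable_fun setT (Im \o h) ->
  (forall x, `|Re (h x)| <= M) -> (forall x, `|Im (h x)| <= M) ->
  complex_integrable setT (fun x => P x * h x).
Proof.
move=> [Pr Pi] mr mi rM iM; split.
  apply: (eq_integrable measurableT _ _ _ (integrableB measurableT
    (integrable_mul_bounded _ _ M Pr mr rM)
    (integrable_mul_bounded _ _ M Pi mi iM))) => // x _ /=.
  by rewrite Re_mulc EFinB.
apply: (eq_integrable measurableT _ _ _ (integrableD measurableT
  (integrable_mul_bounded _ _ M Pr mi iM)
  (integrable_mul_bounded _ _ M Pi mr rM))) => // x _ /=.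
by rewrite Im_mulc EFinD.
Qed.

(** Comparable to the L1 norm of P, and adapted to separate estimates of real and
    imaginary parts. *)
Definition l1_mass P : R := \int[mu]_x (`|Re (P x)| + `|Im (P x)|).

Lemma l1_mass_ge0 P : 0 <= l1_mass P.
Proof. by apply: Rintegral_ge0 => x _; rewrite addr_ge0. Qed.

(** Bounds on h at the frequencies of the spectrum are enough: the compactness of
    the support of the spectrum enters the proof through this estimate. *)
Lemma complex_integral_mul_le P h (e : R) : complex_integrable setT P ->
  complex_integrable setT (fun x => P x * h x) ->
  (forall x, P x != 0 -> `|Re (h x)| <= e /\ `|Im (h x)| <= e) ->
  `|complex_integral setT (fun x => P x * h x)| <= (2 * (l1_mass P * e))%:C.
Proof.
move=> [Pr Pi] [hr hi] he.
have iP : mu.-integrable setT (EFin \o (fun x => `|Re (P x)| + `|Im (P x)|)).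
  apply: (eq_integrable measurableT _ _ _ (integrableD measurableT (integrable_norm Pr)
    (integrable_norm Pi))) => // x _.
have iPe : mu.-integrable setT (EFin \o (fun x => (`|Re (P x)| + `|Im (P x)|) * e)).
  by apply: (eq_integrable measurableT _ _ _ (integrableZlR _ e _ measurableT iP)) => // x _ /=; rewrite mulrC.
have bnd (u v : R -> R) : mu.-integrable setT (EFin \o u) ->
    (forall x, `|u x| <= (`|Re (P x)| + `|Im (P x)|) * e) ->
    `|\int[mu]_x u x| <= l1_mass P * e.
  move=> iu ue; apply: (le_trans (le_normr_Rintegral _ iu)) => //.
  rewrite -RintegralZr//; apply: le_Rintegral => //.
  exact: integrable_norm.
apply: normc_le; apply: bnd => // x.
  have [->|/he[hre him]] := eqVneq (P x) 0.
    by rewrite mul0r /= normr0 addr0 mul0r.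
  rewrite Re_mulc mulrDl (le_trans (ler_normB _ _))// !normrM lerD// ler_wpM2l//.
have [->|/he[hre him]] := eqVneq (P x) 0.
  by rewrite mul0r /= normr0 addr0 mul0r.
by rewrite Im_mulc mulrDl (le_trans (ler_normD _ _))// !normrM lerD// ler_wpM2l.
Qed.

Section ComplexFubini.
Context (P : R -> R[i]) (h : R * R -> R[i]) (M a b : R).
Hypothesis iP : complex_integrable setT P.
Hypothesis mr : measurable_fun [set: R * R] (Re \o h).
Hypothesis mi : measurable_fun [set: R * R] (Im \o h).
Hypothesis rM : forall z, `|Re (h z)| <= M.
Hypothesis iM : forall z, `|Im (h z)| <= M.

Let inner x : R[i] := complex_integral `[a, b] (fun y => h (x, y)).

Lemma complex_integrable_fubini : complex_integrable setT (fun x => P x * inner x).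
Proof.
case: iP => Pr Pi; split.
  apply: (eq_integrable measurableT _ _ _ (integrableB measurableT
    (integrable_fubini_T _ _ _ a b Pr mr rM)
    (integrable_fubini_T _ _ _ a b Pi mi iM))) => // x _ /=.
  by rewrite Re_mulc EFinB.
apply: (eq_integrable measurableT _ _ _ (integrableD measurableT
  (integrable_fubini_T _ _ _ a b Pr mi iM)
  (integrable_fubini_T _ _ _ a b Pi mr rM))) => // x _ /=.
by rewrite Im_mulc EFinD.
Qed.

Let inner_x y : R[i] := complex_integral setT (fun x => P x * h (x, y)).

Let m2 (u : R * R -> R) y :
  measurable_fun setT u -> measurable_fun setT (fun x => u (x, y)).
Proof. by move=> mu_; exact: measurableT_comp mu_ (measurable_pair2 y). Qed.

Let Re_inner_x y : Re (inner_x y) =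
  \int[mu]_x (Re (P x) * Re (h (x, y))) - \int[mu]_x (Im (P x) * Im (h (x, y))).
Proof.
case: iP => Pr Pi; rewrite /inner_x /=; under eq_Rintegral do rewrite Re_mulc.
rewrite RintegralB//.
  exact: (integrable_mul_bounded _ _ M Pr (m2 _ y mr) (fun x => rM (x, y))).
exact: (integrable_mul_bounded _ _ M Pi (m2 _ y mi) (fun x => iM (x, y))).
Qed.

Let Im_inner_x y : Im (inner_x y) =
  \int[mu]_x (Re (P x) * Im (h (x, y))) + \int[mu]_x (Im (P x) * Re (h (x, y))).
Proof.
case: iP => Pr Pi; rewrite /inner_x /=; under eq_Rintegral do rewrite Im_mulc.
rewrite RintegralD//.
  exact: (integrable_mul_bounded _ _ M Pr (m2 _ y mi) (fun x => iM (x, y))).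
exact: (integrable_mul_bounded _ _ M Pi (m2 _ y mr) (fun x => rM (x, y))).
Qed.

Lemma complex_integrable_fubini_itv : complex_integrable `[a, b] inner_x.
Proof.
case: iP => Pr Pi; split.
  apply: (eq_integrable _ _ _ _ (integrableB _
    (integrable_fubini_itv _ _ _ a b Pr mr rM)
    (integrable_fubini_itv _ _ _ a b Pi mi iM))) => // y _.
  by rewrite !compE Re_inner_x EFinB.
apply: (eq_integrable _ _ _ _ (integrableD _
  (integrable_fubini_itv _ _ _ a b Pr mi iM)
  (integrable_fubini_itv _ _ _ a b Pi mr rM))) => // y _.
by rewrite !compE Im_inner_x EFinD.
Qed.

Lemma complex_fubini :
  complex_integral `[a, b] (fun y => complex_integral setT (fun x => P x * h (x, y))) =
  complex_integral setT (fun x => P x * inner x).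
Proof.
case: iP => Pr Pi; apply: complex_ext => /=.
  rewrite -[LHS]/(\int[mu]_(y in `[a, b]) Re (inner_x y)).
  under eq_Rintegral do rewrite Re_inner_x.
  under [RHS]eq_Rintegral do rewrite Re_mulc.
  rewrite !RintegralB//.
  - by rewrite (Rintegral_fubini_itv _ _ _ a b Pr mr rM)
      (Rintegral_fubini_itv _ _ _ a b Pi mi iM).
  - exact: (integrable_fubini_T _ _ _ a b Pr mr rM).
  - exact: (integrable_fubini_T _ _ _ a b Pi mi iM).
  - exact: (integrable_fubini_itv _ _ _ a b Pr mr rM).
  - exact: (integrable_fubini_itv _ _ _ a b Pi mi iM).
rewrite -[LHS]/(\int[mu]_(y in `[a, b]) Im (inner_x y)).
under eq_Rintegral do rewrite Im_inner_x.
under [RHS]eq_Rintegral do rewrite Im_mulc.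
rewrite !RintegralD//.
- by rewrite (Rintegral_fubini_itv _ _ _ a b Pr mi iM)
    (Rintegral_fubini_itv _ _ _ a b Pi mr rM).
- exact: (integrable_fubini_T _ _ _ a b Pr mi iM).
- exact: (integrable_fubini_T _ _ _ a b Pi mr rM).
- exact: (integrable_fubini_itv _ _ _ a b Pr mi iM).
- exact: (integrable_fubini_itv _ _ _ a b Pi mr rM).
Qed.

End ComplexFubini.
End ComplexIntegral.

(** * The evolution in frequency *)

Section Chirp.
Context {R : realType}.
Local Notation Re := (@complex.Re R).
Local Notation Im := (@complex.Im R).

Lemma measurable_Re_expi d (T : measurableType d) (theta : T -> R) :
  measurable_fun setT theta -> measurable_fun setT (Re \o (fun x => expi (theta x))).
Proof.
move=> mtheta; apply: (measurableT_comp (f := @cos R)) mtheta.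
by apply: continuous_measurable_fun; exact: continuous_cos.
Qed.

Lemma measurable_Im_expi d (T : measurableType d) (theta : T -> R) :
  measurable_fun setT theta -> measurable_fun setT (Im \o (fun x => expi (theta x))).
Proof.
move=> mtheta; apply: (measurableT_comp (f := @sin R)) mtheta.
by apply: continuous_measurable_fun; exact: continuous_sin.
Qed.

Lemma Re_expi_le1 (x : R) : `|Re (expi x)| <= 1.
Proof. by rewrite ler_norml cos_geN1 cos_le1. Qed.

Lemma Im_expi_le1 (x : R) : `|Im (expi x)| <= 1.
Proof. by rewrite ler_norml sin_geN1 sin_le1. Qed.

Definition fresnelC (p q : R) : R[i] :=
  fresnel 0 p q +i* fresnel (- (pi / 2)) p q.

Lemma fresnelC_cvg : exists z : R[i], forall M p q, 0 < M -> p <= - M -> M <= q ->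
  `|Re (fresnelC p q - z)| <= 4 / M /\ `|Im (fresnelC p q - z)| <= 4 / M.
Proof.
have [c hc] := fresnel_cvg (0 : R); have [s hs] := fresnel_cvg (- (pi / 2) : R).
exists (c +i* s) => M p q M0 pM Mq.
by split; [exact: hc|exact: hs].
Qed.

Lemma fresnelCE (p q : R) :
  complex_integral `[p, q] (fun s => expi (s ^+ 2)) = fresnelC p q.
Proof.
apply: complex_ext => /=; apply: eq_Rintegral => s _ /=; first by rewrite addr0.
by rewrite cosB cos_pihalf sin_pihalf mulr0 add0r mulr1.
Qed.

(** An affine change of variable reduces the quadratic phase to s ^ 2. *)
Lemma complex_integral_chirp (theta m r a b : R) : 0 < r -> a <= b ->
  complex_integral `[a, b] (fun y => expi (theta + ((y - m) / r) ^+ 2)) =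
  r%:C * expi theta * fresnelC ((a - m) / r) ((b - m) / r).
Proof.
move=> r0 ab; under eq_complex_integral do rewrite expiD.
have csq (g : R -> R) : continuous g -> continuous (fun s : R => g (s ^+ 2)).
  by move=> cg s; apply: continuous_comp; [exact: exprn_continuous|exact: cg].
have caff (y : R) : {for y, continuous (fun y : R => (y - m) / r)}.
  by apply: cvgM; [apply: cvgB; [exact: cvg_id|]|]; exact: cvg_cst.
rewrite complex_integralZl//; last first.
  split; apply: within_continuous_integrable => y _.
    apply: (@continuous_comp _ _ _ (fun y : R => (y - m) / r) (fun s => cos (s ^+ 2))).
      exact: caff.
    by apply: csq; exact: continuous_cos.
  apply: (@continuous_comp _ _ _ (fun y : R => (y - m) / r) (fun s => sin (s ^+ 2))).
    exact: caff.
  by apply: csq; exact: continuous_sin.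
rewrite (mulrC r%:C) -[RHS]mulrA; congr (_ * _).
rewrite -fresnelCE; apply: complex_ext; rewrite ?Re_mulc ?Im_mulc /= mul0r ?subr0 ?addr0.
  rewrite -(Rintegral_affine (fun s => cos (s ^+ 2)))//.
  by apply: csq; exact: continuous_cos.
rewrite -(Rintegral_affine (fun s => sin (s ^+ 2)))//.
by apply: csq; exact: continuous_sin.
Qed.

End Chirp.

Section Evolution.
Context {R : realType} (Psi P : R -> R[i]).
Local Notation Re := (@complex.Re R).
Local Notation Im := (@complex.Im R).
Hypothesis iP : complex_integrable setT P.
Hypothesis PsiE : forall x : R, Psi x = ((2 * pi)^-1)%:C *
     complex_integral setT (fun xi => P xi * expi (x * xi)).

(** The wave number to which scaling and modulation send the frequency xi. *)
Definition wavenumber (alpha omega xi : R) : R := xi / 2 `^ alpha + omega.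

(** The translation by tau contributes the first term; a plane wave of wave number k
    evolves with the phase k x - t k ^ 2. *)
Definition phase (t x tau alpha omega xi : R) : R :=
  - (tau * xi / 2 `^ alpha) + wavenumber alpha omega xi * x
  - t * wavenumber alpha omega xi ^+ 2.

(** The critical point, in the position y, of the phase of the integrand at
    frequency xi; the group velocity of the wave number k is 2 k. *)
Definition stationary_point (t x alpha omega xi : R) : R :=
  x - 2 * t * wavenumber alpha omega xi.

Lemma measurable_wavenumber alpha omega :
  measurable_fun setT (wavenumber alpha omega).
Proof. by apply: measurable_funD => //; apply: measurable_funM. Qed.

Lemma measurable_phase t x tau alpha omega :
  measurable_fun setT (phase t x tau alpha omega).
Proof.
apply: measurable_funB; [apply: measurable_funD|].
- by apply: measurableT_comp => //; apply: measurable_funM => //.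
- by apply: measurable_funM => //; exact: measurable_wavenumber.
- by apply: measurable_funM => //; apply: measurable_funX; exact: measurable_wavenumber.
Qed.

(** The phase of the integrand at frequency z.1 and position z.2, with the square
    completed in z.2. *)
Definition chirp_phase t x tau alpha omega (z : R * R) : R :=
  phase t x tau alpha omega z.1 +
  ((z.2 - stationary_point t x alpha omega z.1) / Num.sqrt (4 * t)) ^+ 2.

Lemma measurable_chirp_phase t x tau alpha omega :
  measurable_fun setT (chirp_phase t x tau alpha omega).
Proof.
apply: measurable_funD.
  exact: measurableT_comp (measurable_phase _ _ _ _ _) measurable_fst.
apply: measurable_funX; apply: measurable_funM => //.
apply: measurable_funB => //; apply: measurable_funB => //; apply: measurable_funM => //.
exact: measurableT_comp (measurable_wavenumber _ _) measurable_fst.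
Qed.

Definition evolution_factor (t alpha : R) : R[i] :=
  (2 `^ (- (alpha / 2)))%:C * ((2 * pi)^-1)%:C *
  (expi (pi / 4) * (Num.sqrt (4 * pi * t))%:C)^-1.

(** The three phases u xi, omega y and (x - y) ^ 2 / (4 t) add up to a quadratic
    polynomial of y, whose square is completed. *)
Lemma atom_kernelE tau alpha omega t x y : 0 < t ->
  atom Psi tau alpha omega y * schrodinger_kernel t (x - y) =
  evolution_factor t alpha * complex_integral setT
    (fun xi => P xi * expi (chirp_phase t x tau alpha omega (xi, y))).
Proof.
move=> t0; rewrite /atom PsiE /schrodinger_kernel /evolution_factor.
set A := (_ `^ _)%:C; set k := _%:C; set D := _^-1.
set u := (y - tau) / 2 `^ alpha.
have -> : complex_integral setT
    (fun xi => P xi * expi (chirp_phase t x tau alpha omega (xi, y))) =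
  expi (omega * y + (x - y) ^+ 2 / (4 * t)) *
    complex_integral setT (fun xi => P xi * expi (u * xi)).
  rewrite -complex_integralZl//; last first.
    apply: (complex_integrable_mul _ _ 1) => //.
    - by apply: measurable_Re_expi; exact: measurable_funM.
    - by apply: measurable_Im_expi; exact: measurable_funM.
    - by move=> xi; exact: Re_expi_le1.
    - by move=> xi; exact: Im_expi_le1.
  congr complex_integral; apply/funext => xi.
  rewrite mulrCA -expiD; congr (_ * expi _).
  rewrite /chirp_phase /phase /stationary_point /wavenumber /u /=.
  have : Num.sqrt (4 * t) ^+ 2 = 4 * t by rewrite sqr_sqrtr// mulr_ge0// ltW.
  have : 0 < Num.sqrt (4 * t) by rewrite sqrtr_gt0 mulr_gt0.
  have : 0 < 2 `^ alpha :> R by rewrite powR_gt0.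
  move: (2 `^ alpha) (Num.sqrt (4 * t)) => s r s0 r0 rt.
  have -> : t = r ^+ 2 / 4 by rewrite rt; field.
  by field; rewrite !gt_eqF.
rewrite expiD; ring.
Qed.

(** Fubini puts the integral over y inside, where it is a Fresnel integral. *)
Lemma truncated_evolutionE tau alpha omega t x a b : 0 < t -> a <= b ->
  let r := Num.sqrt (4 * t) in let m := stationary_point t x alpha omega in
  let h := fun xi => r%:C * expi (phase t x tau alpha omega xi) *
      fresnelC ((a - m xi) / r) ((b - m xi) / r) in
  complex_integrable setT (fun xi => P xi * h xi) /\
  truncated_evolution (atom Psi tau alpha omega) t x (a, b) =
  evolution_factor t alpha * complex_integral setT (fun xi => P xi * h xi).
Proof.
move=> t0 ab r m h; have r0 : 0 < r by rewrite sqrtr_gt0 mulr_gt0.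
pose H z := expi (chirp_phase t x tau alpha omega z).
have mr := measurable_Re_expi _ _ _ (measurable_chirp_phase t x tau alpha omega).
have mi := measurable_Im_expi _ _ _ (measurable_chirp_phase t x tau alpha omega).
have rM z : `|Re (H z)| <= 1 by exact: Re_expi_le1.
have iM z : `|Im (H z)| <= 1 by exact: Im_expi_le1.
have hE xi : complex_integral `[a, b] (fun y => H (xi, y)) = h xi.
  exact: (complex_integral_chirp (phase t x tau alpha omega xi) (m xi) r a b r0 ab).
rewrite (_ : (fun xi => P xi * h xi) =
    (fun xi => P xi * complex_integral `[a, b] (fun y => H (xi, y)))); last first.
  by apply/funext => xi; rewrite hE.
split; first exact: complex_integrable_fubini iP mr mi rM iM.
rewrite /truncated_evolution /= -(complex_fubini _ _ _ a b iP mr mi rM iM).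
rewrite -complex_integralZl//.
  by congr complex_integral; apply/funext => y; rewrite atom_kernelE.
exact: complex_integrable_fubini_itv iP mr mi rM iM.
Qed.

End Evolution.

Section EvolutionLimit.
Context {R : realType} (Psi P : R -> R[i]) (L : R).
Local Notation Re := (@complex.Re R).
Local Notation Im := (@complex.Im R).
Hypothesis iP : complex_integrable setT P.
Hypothesis PsiE : forall x : R, Psi x = ((2 * pi)^-1)%:C *
     complex_integral setT (fun xi => P xi * expi (x * xi)).
Hypothesis suppP : forall xi, P xi != 0 -> `|xi| <= L.

Hypothesis L0 : 0 <= L.

Lemma rotation_le (theta e : R) (w : R[i]) : `|Re w| <= e -> `|Im w| <= e ->
  `|Re (expi theta * w)| <= 2 * e /\ `|Im (expi theta * w)| <= 2 * e.
Proof.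
move=> Re_e Im_e; have e0 : 0 <= e by exact: le_trans Re_e.
have bnd (u v : R) : `|u| <= 1 -> `|v| <= e -> `|u * v| <= e.
  by move=> u1 ve; rewrite normrM -[leRHS]mul1r ler_pM.
rewrite Re_mulc Im_mulc mulr_natl mulr2n; split.
  by rewrite (le_trans (ler_normB _ _))// lerD// bnd// (Re_expi_le1, Im_expi_le1).
by rewrite (le_trans (ler_normD _ _))// lerD// bnd// (Re_expi_le1, Im_expi_le1).
Qed.

Lemma wavenumber_le alpha omega xi : `|xi| <= L ->
  `|wavenumber alpha omega xi| <= L / 2 `^ alpha + `|omega|.
Proof.
move=> xiL; rewrite (le_trans (ler_normD _ _))// lerD2r normrM.
by rewrite [X in _ * X]ger0_norm ?ler_wpM2r// invr_ge0 powR_ge0.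
Qed.

Lemma near_large_interval (M : R) :
  \forall ab \near filter_prod (-oo)%R (+oo)%R, ab.1 <= - M /\ M <= ab.2.
Proof.
exists ([set a : R | a <= - M], [set b : R | M <= b]) => //=; split.
  exact: nbhs_ninfty_le (num_real _).
exact: nbhs_pinfty_ge (num_real _).
Qed.

(** For xi in the bounded support of P the stationary points stay in a fixed
    segment. The end points of the Fresnel integrals therefore go to infinity
    uniformly in xi, and the limit passes under the spectral integral. *)
Lemma evolution_cvg_to (z : R[i]) tau alpha omega t x : 0 < t ->
  (forall M p q, 0 < M -> p <= - M -> M <= q ->
    `|Re (fresnelC p q - z)| <= 4 / M /\ `|Im (fresnelC p q - z)| <= 4 / M) ->
  evolution_filter (atom Psi tau alpha omega) t x -->
  (evolution_factor t alpha * complex_integral setT (fun xi =>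
    P xi * ((Num.sqrt (4 * t))%:C * expi (phase t x tau alpha omega xi) * z)) : R[i]^o).
Proof.
move=> t0 hz; set r := Num.sqrt (4 * t); set Fa := evolution_factor t alpha.
pose th := phase t x tau alpha omega.
have r0 : 0 < r by rewrite sqrtr_gt0 mulr_gt0.
have iPz : complex_integrable setT (fun xi => P xi * (r%:C * expi (th xi) * z)).
  rewrite (_ : (fun xi => _) = (fun xi => (r%:C * z) * (P xi * expi (th xi)))).
    2: by apply/funext => xi; ring.
  apply: complex_integrableZl => //; apply: (complex_integrable_mul _ _ 1) => //.
  - by apply: measurable_Re_expi; exact: measurable_phase.
  - by apply: measurable_Im_expi; exact: measurable_phase.
  - by move=> xi; exact: Re_expi_le1.
  - by move=> xi; exact: Im_expi_le1.
apply/cvgrPdist_le => e; rewrite ltcE /= => /andP[/eqP Ime Ree].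
have -> : e = (Re e)%:C by apply: complex_ext.
move: (Re e) Ree => {Ime}{}e e0.
pose K := l1_mass P; have K0 : 0 <= K := l1_mass_ge0 P.
pose nF := Num.sqrt (Re Fa ^+ 2 + Im Fa ^+ 2).
have nF0 : 0 <= nF := sqrtr_ge0 _.
(* B / M will bound the distance to the limit once both end points of the
   Fresnel integrals are beyond M; m0 bounds the stationary points. *)
pose B := nF * (2 * (K * (r * 8))).
have B0 : 0 <= B by rewrite !mulr_ge0// ltW.
pose M := B / e + 1.
have M0 : 0 < M by rewrite ltr_wpDl// divr_ge0// ltW.
pose m0 := `|x| + 2 * t * (L / 2 `^ alpha + `|omega|).
have k0 : 0 <= L / 2 `^ alpha + `|omega| by rewrite addr_ge0// divr_ge0// powR_ge0.
have m00 : 0 <= m0 by rewrite addr_ge0// mulr_ge0// mulr_ge0// ltW.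
have Mm0 : 0 <= M * r + m0 by rewrite addr_ge0// mulr_ge0// ltW.
near=> c.
have [aM bM] : c.1 <= - (M * r + m0) /\ M * r + m0 <= c.2.
  by near: c; exact: near_large_interval.
rewrite (surjective_pairing c); move: c.1 c.2 aM bM => a b aM bM.
have ab : a <= b by rewrite (le_trans aM)// (le_trans _ bM)//; lra.
have [iPh TE] := truncated_evolutionE _ _ iP PsiE tau alpha omega t x a b t0 ab.
rewrite TE -/r -/th -/Fa -mulrBr complex_integralB//.
set m := stationary_point t x alpha omega.
rewrite (@eq_complex_integral _ _ _ (fun xi => P xi * (r%:C * (expi (th xi) *
   (z - fresnelC ((a - m xi) / r) ((b - m xi) / r)))))); last first.
  by move=> xi; ring.
pose g xi := r%:C * (expi (th xi) * (z - fresnelC ((a - m xi) / r) ((b - m xi) / r))).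
have gle xi : P xi != 0 ->
    `|Re (g xi)| <= r * (8 / M) /\ `|Im (g xi)| <= r * (8 / M).
  move=> /suppP xiL.
  have mxi : `|m xi| <= m0.
    rewrite /m /stationary_point (le_trans (ler_normB _ _))// lerD2l.
    have t20 : 0 <= 2 * t by rewrite mulr_ge0// ltW.
    by rewrite normrM (ger0_norm t20) ler_wpM2l// wavenumber_le.
  have pM : (a - m xi) / r <= - M.
    rewrite ler_pdivrMr//; move: mxi; rewrite ler_norml => /andP[]; nra.
  have qM : M <= (b - m xi) / r.
    rewrite ler_pdivlMr//; move: mxi; rewrite ler_norml => /andP[]; nra.
  have [Rw Iw] := hz _ _ _ M0 pM qM.
  have Nw (w : R[i]) : (`|Re (- w)| = `|Re w|) * (`|Im (- w)| = `|Im w|).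
    by case: w => u v; rewrite /= !normrN.
  have [Rg Ig] : `|Re (expi (th xi) * (z - fresnelC ((a - m xi) / r) ((b - m xi) / r)))|
      <= 2 * (4 / M) /\
     `|Im (expi (th xi) * (z - fresnelC ((a - m xi) / r) ((b - m xi) / r)))| <= 2 * (4 / M).
    by apply: rotation_le; rewrite -opprB Nw.
  move: Rg Ig; rewrite /g; move: (expi (th xi) * _) => w Rg Ig.
  rewrite Re_mulc Im_mulc /= !mul0r subr0 addr0 !normrM (ger0_norm (ltW r0)).
  have -> : 8 / M = 2 * (4 / M) by field; rewrite gt_eqF.
  by rewrite !ler_wpM2l// ltW.
have ig : complex_integrable setT (fun xi => P xi * g xi).
  rewrite (_ : (fun xi => _) = (fun xi => P xi * (r%:C * expi (th xi) * z) -
    P xi * (r%:C * expi (th xi) * fresnelC ((a - m xi) / r) ((b - m xi) / r)))).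
    exact: complex_integrableB.
  by apply/funext => xi; rewrite /g; ring.
have := complex_integral_mul_le P g _ iP ig gle.
rewrite normrM => gint; apply: (le_trans (ler_wpM2l (normr_ge0 _) gint)).
rewrite normc_def -/nF -rmorphM lecR /=.
have -> : nF * (2 * (l1_mass P * (r * (8 / M)))) = B / M.
  by rewrite /B /K; field; rewrite gt_eqF.
rewrite ler_pdivrMr// /M mulrDr mulr1 mulrCA divff ?gt_eqF// mulr1 lerDl ltW//.
Unshelve. all: by end_near.
Qed.

End EvolutionLimit.

(** * The approximants in frequency *)

Section Spectral.
Context {R : realType} (Psi P : R -> R[i]) (L : R).
Local Notation Re := (@complex.Re R).
Local Notation Im := (@complex.Im R).
Hypothesis iP : complex_integrable setT P.
Hypothesis PsiE : forall x : R, Psi x = ((2 * pi)^-1)%:C *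
     complex_integral setT (fun xi => P xi * expi (x * xi)).
Hypothesis suppP : forall xi, P xi != 0 -> `|xi| <= L.
Hypothesis L0 : 0 <= L.

(** Here v stands for (tau, alpha, omega) and tx for (t, x). *)
Definition spectral_wave (tx : R * R) (xi : R) (v : R * R * R) : R[i] :=
  (2 `^ (- (v.1.2 / 2)))%:C * expi (phase tx.1 tx.2 v.1.1 v.1.2 v.2 xi).

Lemma spectral_wave_integrable tx v :
  complex_integrable setT (fun xi => P xi * spectral_wave tx xi v).
Proof.
rewrite (_ : (fun xi => _) = (fun xi => (2 `^ (- (v.1.2 / 2)))%:C *
    (P xi * expi (phase tx.1 tx.2 v.1.1 v.1.2 v.2 xi)))).
  2: by apply/funext => xi; rewrite /spectral_wave mulrCA.
apply: complex_integrableZl => //; apply: (complex_integrable_mul _ _ 1) => //.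
- by apply: measurable_Re_expi; exact: measurable_phase.
- by apply: measurable_Im_expi; exact: measurable_phase.
- by move=> xi; exact: Re_expi_le1.
- by move=> xi; exact: Im_expi_le1.
Qed.

(** The factor sqrt (4 t) of the change of variable cancels the one in the kernel,
    which makes kap independent of time. *)
Lemma evolution_spectral : exists kap : R[i], forall tau alpha omega t x, 0 < t ->
  evolution_filter (atom Psi tau alpha omega) t x -->
  (kap * complex_integral setT (fun xi =>
    P xi * spectral_wave (t, x) xi (tau, alpha, omega)) : R[i]^o).
Proof.
have [z hz] := @fresnelC_cvg R.
exists (((2 * pi)^-1)%:C * (expi (pi / 4) * (Num.sqrt pi)%:C)^-1 * z).
move=> tau alpha omega t x t0.
have := evolution_cvg_to _ _ _ iP PsiE suppP L0 z tau alpha omega t x t0 hz.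
have iE : complex_integrable setT (fun xi => P xi * expi (phase t x tau alpha omega xi)).
  apply: (complex_integrable_mul _ _ 1) => //.
  - by apply: measurable_Re_expi; exact: measurable_phase.
  - by apply: measurable_Im_expi; exact: measurable_phase.
  - by move=> xi; exact: Re_expi_le1.
  - by move=> xi; exact: Im_expi_le1.
set r := Num.sqrt (4 * t).
have r0 : r%:C != 0 by rewrite (inj_eq (@complexI R)) gt_eqF// sqrtr_gt0 mulr_gt0.
pose I := complex_integral setT (fun xi => P xi * expi (phase t x tau alpha omega xi)).
have I1 : complex_integral setT (fun xi =>
    P xi * (r%:C * expi (phase t x tau alpha omega xi) * z)) = r%:C * z * I.
  rewrite -complex_integralZl//.
  by apply: eq_complex_integral => xi; ring.
have I2 : complex_integral setT (fun xi =>
    P xi * spectral_wave (t, x) xi (tau, alpha, omega)) = (2 `^ (- (alpha / 2)))%:C * I.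
  rewrite -complex_integralZl//.
  by apply: eq_complex_integral => xi; rewrite /spectral_wave mulrCA.
rewrite I1 I2 /evolution_factor.
have -> : Num.sqrt (4 * pi * t) = Num.sqrt pi * r.
  by rewrite mulrAC [RHS]mulrC sqrtrM// mulr_ge0// ltW.
move: I (2 `^ _)%:C (_^-1)%:C {I1 I2} => I A k.
rewrite rmorphM /= !invfM.
have -> : A * k * ((expi (pi / 4))^-1 * ((Num.sqrt pi)%:C^-1 / r%:C)) * (r%:C * z * I) =
  A * k * ((expi (pi / 4))^-1 * ((Num.sqrt pi)%:C^-1 * (r%:C / r%:C))) * (z * I) by ring.
rewrite (divff r0) mulr1.
set e := (expi _)^-1; set s := (Num.sqrt pi)%:C^-1.
have -> : A * k * (e * s) * (z * I) = k * (e * s) * z * (A * I) by ring.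
exact.
Qed.

(** The wave is built from tau, omega and the exponentials of multiples of alpha by
    sums, products, cos and sin; in its constant t, x and xi occur only through
    their bounds. *)
Lemma spectral_wave_majorized (rho T : R) : 0 <= rho -> 0 <= T ->
  exists C, 0 <= C /\ forall tx xi, `|tx.1| <= T -> `|tx.2| <= T -> `|xi| <= L ->
    majorized rho (fun v => Re (spectral_wave tx xi v)) C /\
    majorized rho (fun v => Im (spectral_wave tx xi v)) C.
Proof.
move=> rho0 T0.
pose l2 : R := ln 2.
have l20 : 0 <= l2 by rewrite ln_ge0// ler1n.
pose CE := expR (l2 * rho); pose Ck := L * CE + rho.
pose Cth := rho * (L * CE) + Ck * T + T * Ck ^+ 2.
pose C := expR (l2 / 2 * rho) * expR Cth.
exists C; split; first by rewrite mulr_ge0// expR_ge0.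
move=> [t x] xi /= tT xT xiL.
have m1 : majorized rho (fun v => v.1.1) rho.
  apply: (@eq_majorized _ _ (fun v => 1 * (v.1.1 ^+ 1 * v.1.2 ^+ 0 * v.2 ^+ 0))).
    by move=> v; rewrite !expr0 !mulr1 mul1r.
  by apply: majorized_monomial; rewrite normr1 mul1r.
have m2 : majorized rho (fun v => v.1.2) rho.
  apply: (@eq_majorized _ _ (fun v => 1 * (v.1.1 ^+ 0 * v.1.2 ^+ 1 * v.2 ^+ 0))).
    by move=> v; rewrite !expr0 !mulr1 !mul1r.
  by apply: majorized_monomial; rewrite normr1 mul1r.
have m3 : majorized rho (fun v => v.2) rho.
  apply: (@eq_majorized _ _ (fun v => 1 * (v.1.1 ^+ 0 * v.1.2 ^+ 0 * v.2 ^+ 1))).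
    by move=> v; rewrite !expr0 !mul1r.
  by apply: majorized_monomial; rewrite normr1 mul1r.
have mZ c D f : `|c| <= D -> forall E, majorized rho f E ->
    majorized rho (fun v => c * f v) (D * E).
  by move=> cD E fE; apply: majorizedM => //; exact: majorized_cst.
have powE a : 2 `^ a = expR (l2 * a) :> R by rewrite /powR pnatr_eq0/= mulrC.
have mE : majorized rho (fun v => expR (- l2 * v.1.2)) CE.
  by apply: majorized_expR => //; apply: mZ => //; rewrite normrN ger0_norm.
have mA : majorized rho (fun v => expR (- (l2 / 2) * v.1.2)) (expR (l2 / 2 * rho)).
  by apply: majorized_expR => //; apply: mZ => //; rewrite normrN ger0_norm// divr_ge0.
have mk : majorized rho (fun v => xi * expR (- l2 * v.1.2) + v.2) Ck.
  by apply: majorizedD => //; apply: mZ.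
have mth : majorized rho (fun v => phase t x v.1.1 v.1.2 v.2 xi) Cth.
  apply: (@eq_majorized _ _ (fun v => v.1.1 * ((- xi) * expR (- l2 * v.1.2)) +
    (xi * expR (- l2 * v.1.2) + v.2) * x +
    (- t) * (xi * expR (- l2 * v.1.2) + v.2) ^+ 2)).
    move=> v; rewrite /phase /wavenumber powE.
    have -> : expR (- l2 * v.1.2) = (expR (l2 * v.1.2))^-1 by rewrite mulNr expRN.
    move: (expR _)^-1 => E; ring.
  apply: majorizedD; [apply: majorizedD|].
  - by apply: majorizedM => //; apply: mZ => //; rewrite normrN.
  - by apply: majorizedM => //; exact: majorized_cst.
  - by apply: mZ; [rewrite normrN|exact: majorizedX].
have AE v : 2 `^ (- (v.1.2 / 2)) = expR (- (l2 / 2) * v.1.2) :> R.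
  by rewrite powE; congr expR; ring.
split.
  apply: (@eq_majorized _ _ (fun v => expR (- (l2 / 2) * v.1.2) *
      cos (phase t x v.1.1 v.1.2 v.2 xi))).
    by move=> v; rewrite /= mul0r subr0 AE.
  by apply: majorizedM => //; exact: majorized_cos.
apply: (@eq_majorized _ _ (fun v => expR (- (l2 / 2) * v.1.2) *
    sin (phase t x v.1.1 v.1.2 v.2 xi))).
  by move=> v; rewrite /= mul0r addr0 AE.
by apply: majorizedM => //; exact: majorized_sin.
Qed.

(** Integrated against P it gives the approximant, up to the constant kap. *)
Definition mixture N v tx xi : R[i] :=
  \sum_(nu1 < N.1.1.+1) \sum_(nu2 < N.1.2.+1) \sum_(nu3 < N.2.+1)
    (weight N.1.1 nu1 v.1.1 * weight N.1.2 nu2 v.1.2 * weight N.2 nu3 v.2)%:C *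
    spectral_wave tx xi (node N.1.1 nu1, node N.1.2 nu2, node N.2 nu3).

Lemma mul_mixture N v tx xi : P xi * mixture N v tx xi =
  \sum_(nu1 < N.1.1.+1) \sum_(nu2 < N.1.2.+1) \sum_(nu3 < N.2.+1)
    (weight N.1.1 nu1 v.1.1 * weight N.1.2 nu2 v.1.2 * weight N.2 nu3 v.2)%:C *
    (P xi * spectral_wave tx xi (node N.1.1 nu1, node N.1.2 nu2, node N.2 nu3)).
Proof.
rewrite mulr_sumr; apply: eq_bigr => n1 _; rewrite mulr_sumr.
apply: eq_bigr => n2 _; rewrite mulr_sumr; apply: eq_bigr => n3 _.
by rewrite mulrCA.
Qed.

Lemma mixture_integrable N v tx : complex_integrable setT (fun xi => P xi * mixture N v tx xi).
Proof.
rewrite (funext (mul_mixture N v tx)).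
do 3 (apply: complex_integrable_sum => // ?).
by apply: complex_integrableZl => //; exact: spectral_wave_integrable.
Qed.

Lemma integral_mixture N v tx :
  complex_integral setT (fun xi => P xi * mixture N v tx xi) =
  \sum_(nu1 < N.1.1.+1) \sum_(nu2 < N.1.2.+1) \sum_(nu3 < N.2.+1)
    (weight N.1.1 nu1 v.1.1 * weight N.1.2 nu2 v.1.2 * weight N.2 nu3 v.2)%:C *
    complex_integral setT (fun xi =>
      P xi * spectral_wave tx xi (node N.1.1 nu1, node N.1.2 nu2, node N.2 nu3)).
Proof.
have iw u (c : R[i]) : complex_integrable setT (fun xi => c * (P xi * spectral_wave tx xi u)).
  by apply: complex_integrableZl => //; exact: spectral_wave_integrable.
rewrite (eq_complex_integral _ _ _ (mul_mixture N v tx)).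
rewrite complex_integral_sum//; last first.
  by move=> n1; do 2 (apply: complex_integrable_sum => // ?).
apply: eq_bigr => n1 _; rewrite complex_integral_sum//; last first.
  by move=> n2; apply: complex_integrable_sum => // ?.
apply: eq_bigr => n2 _; rewrite complex_integral_sum//.
apply: eq_bigr => n3 _; rewrite complex_integralZl//.
exact: spectral_wave_integrable.
Qed.

Lemma Re_sum (I : Type) (s : seq I) (F : I -> R[i]) :
  Re (\sum_(i <- s) F i) = \sum_(i <- s) Re (F i).
Proof. by elim/big_rec2: _ => // i x y _ <-; rewrite Re_addc. Qed.

Lemma Im_sum (I : Type) (s : seq I) (F : I -> R[i]) :
  Im (\sum_(i <- s) F i) = \sum_(i <- s) Im (F i).
Proof. by elim/big_rec2: _ => // i x y _ <-; rewrite Im_addc. Qed.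

Lemma Re_scale (r : R) (z : R[i]) : Re (r%:C * z) = r * Re z.
Proof. by rewrite Re_mulc /= mul0r subr0. Qed.

Lemma Im_scale (r : R) (z : R[i]) : Im (r%:C * z) = r * Im z.
Proof. by rewrite Im_mulc /= mul0r addr0. Qed.

Lemma Re_mixture N v tx xi :
  Re (mixture N v tx xi) = bernstein3 N v (fun u => Re (spectral_wave tx xi u)).
Proof.
rewrite /mixture /bernstein3 Re_sum; apply: eq_bigr => n1 _.
rewrite Re_sum; apply: eq_bigr => n2 _.
by rewrite Re_sum; apply: eq_bigr => n3 _; rewrite Re_scale.
Qed.

Lemma Im_mixture N v tx xi :
  Im (mixture N v tx xi) = bernstein3 N v (fun u => Im (spectral_wave tx xi u)).
Proof.
rewrite /mixture /bernstein3 Im_sum; apply: eq_bigr => n1 _.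
rewrite Im_sum; apply: eq_bigr => n2 _.
by rewrite Im_sum; apply: eq_bigr => n3 _; rewrite Im_scale.
Qed.

(** Real and imaginary parts of the mixture are Bernstein approximants of those of
    the wave, with an error uniform over the spectrum. *)
Lemma mixture_approx v (T : R) : 0 <= T -> exists2 C, 0 <= C &
  forall N tx, (0 < N.1.1)%N -> (0 < N.1.2)%N -> (0 < N.2)%N ->
    `|tx.1| <= T -> `|tx.2| <= T ->
    `|complex_integral setT (fun xi => P xi * spectral_wave tx xi v) -
      complex_integral setT (fun xi => P xi * mixture N v tx xi)|
    <= (C * inv_sum N)%:C.
Proof.
move=> T0; pose A : R := 1 + `|v.1.1| + `|v.1.2| + `|v.2|.
have := normr_ge0 v.1.1; have := normr_ge0 v.1.2; have := normr_ge0 v.2.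
move=> v30 v20 v10.
have rho0 : 0 <= 4 * A by rewrite mulr_ge0// /A; lra.
have [C [C0 mC]] := spectral_wave_majorized (4 * A) T rho0 T0.
exists (2 * l1_mass P * C); first by rewrite !mulr_ge0// l1_mass_ge0.
move=> N tx N1 N2 N3 tT xT.
rewrite complex_integralB//; [|exact: spectral_wave_integrable|exact: mixture_integrable].
have -> : 2 * l1_mass P * C * inv_sum N = 2 * (l1_mass P * (C * inv_sum N)) by ring.
rewrite (@eq_complex_integral _ _ _
  (fun xi => P xi * (spectral_wave tx xi v - mixture N v tx xi))); last first.
  by move=> xi; rewrite mulrBr.
apply: complex_integral_mul_le => //.
  rewrite (_ : (fun xi => _) = (fun xi =>
      P xi * spectral_wave tx xi v - P xi * mixture N v tx xi)).
    apply: complex_integrableB => //.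
      exact: spectral_wave_integrable.
    exact: mixture_integrable.
  by apply/funext => xi; rewrite mulrBr.
move=> xi /suppP xiL; have [mR mI] := mC tx xi tT xT xiL.
have A1 : 1 <= A by rewrite /A; lra.
have v1A : `|v.1.1| <= A by rewrite /A; lra.
have v2A : `|v.1.2| <= A by rewrite /A; lra.
have v3A : `|v.2| <= A by rewrite /A; lra.
have ReB (z w : R[i]) : Re (z - w) = Re z - Re w by case: z w => ? ? [].
have ImB (z w : R[i]) : Im (z - w) = Im z - Im w by case: z w => ? ? [].
rewrite ReB ImB Re_mixture Im_mixture ![`|_ - bernstein3 _ _ _|]distrC.
by split; [apply: (bernstein3_sub _ _ _ _ _ A1 v1A v2A v3A N1 N2 N3 mR)|
  apply: (bernstein3_sub _ _ _ _ _ A1 v1A v2A v3A N1 N2 N3 mI)].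
Qed.

End Spectral.

Lemma near_inv_sum_le (R : realType) (e : R) : 0 < e ->
  \forall N \near min_to_infty, [/\ (0 < N.1.1)%N, (0 < N.1.2)%N, (0 < N.2)%N &
    inv_sum N <= e].
Proof.
move=> e0; have e30 : 0 < e / 3 by rewrite divr_gt0.
have [n _ Hn] := near_infty_natSinv_lt (PosNum e30).
have small m : (n < m)%N -> (0 < m)%N /\ m%:R^-1 <= e / 3.
  case: m => // m nm; split=> //; rewrite ltW//.
  exact: (Hn m).
have nearn : \forall m \near \oo, (n < m)%N by exact: nbhs_infty_gt.
exists ([set N | (n < N.1)%N /\ (n < N.2)%N], [set m | (n < m)%N]) => /=.
  split=> //; exists ([set m | (n < m)%N], [set m | (n < m)%N]) => //=.
move=> [[N1 N2] N3] /= [[/small[N10 h1] /small[N20 h2]] /small[N30 h3]]; split => //.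
rewrite /inv_sum /=; lra.
Qed.

Theorem proposition5p6 (R : realType) (Psi Psihat : R -> R[i])
  (Psihat_L1 : complex_integrable setT Psihat)
  (Psihat_supp : compactly_supported Psihat)
  (PsiE : forall x : R, Psi x = ((2 * pi)^-1)%:C *
     complex_integral setT (fun xi => Psihat xi * expi (x * xi))) :
  (forall tau alpha omega t x : R, 0 < t ->
     cvg (evolution_filter (atom Psi tau alpha omega) t x)) /\
  (forall (tau alpha omega : R) (K : set (R * R)),
     compact K -> K `<=` [set tx | 0 < tx.1] ->
     {uniform K, approximant Psi tau alpha omega N @[N --> min_to_infty]
        --> psi Psi tau alpha omega}).
Proof.
have [L L0 suppP] : exists2 L : R, 0 <= L & forall xi, Psihat xi != 0 -> `|xi| <= L.
  have [M [_ HM]] := compact_bounded Psihat_supp.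
  exists (`|M| + 1); first by rewrite addr_ge0.
  move=> xi Pxi; apply: HM; first by rewrite (le_lt_trans (ler_norm _))// ltrDl.
  exact: subset_closure.
have [kap cvg_kap] := evolution_spectral _ _ _ Psihat_L1 PsiE suppP L0.
split=> [tau alpha omega t x t0|tau alpha omega K cK Kpos].
  by apply/cvg_ex; eexists; exact: cvg_kap.
have psiE v tx : 0 < tx.1 -> psi Psi v.1.1 v.1.2 v.2 tx =
    kap * complex_integral setT (fun xi => Psihat xi * spectral_wave tx xi v).
  move: v tx => [[tau' alpha'] omega'] [t x] /= t0.
  rewrite /psi /evolution; apply: cvg_lim; first exact: norm_hausdorff.
  exact: cvg_kap.
have approxE N tx : 0 < tx.1 -> approximant Psi tau alpha omega N tx =
    kap * complex_integral setT
      (fun xi => Psihat xi * mixture N (tau, alpha, omega) tx xi).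
  move=> t0; rewrite integral_mixture//; case: N => [[N1 N2] N3] /=.
  rewrite mulr_sumr; apply: eq_bigr => n1 _; rewrite mulr_sumr.
  apply: eq_bigr => n2 _; rewrite mulr_sumr; apply: eq_bigr => n3 _.
  by rewrite (psiE (node N1 n1, node N2 n2, node N3 n3))// mulrCA.
have [T T0 KT] : exists2 T : R, 0 <= T & forall tx, K tx -> `|tx.1| <= T /\ `|tx.2| <= T.
  have [M [_ HM]] := compact_bounded cK.
  exists (`|M| + 1); first by rewrite addr_ge0.
  have M1 : M < `|M| + 1 by rewrite (le_lt_trans (ler_norm _))// ltrDl.
  move=> tx Ktx; have := HM _ M1 tx Ktx.
  by rewrite /= prod_normE ge_max => /andP.
have [C C0 HC] := mixture_approx _ _ Psihat_L1 suppP (tau, alpha, omega) T T0.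
move=> U /uniform_nbhs [E [entE EU]].
have [e /= e0 ballE] : exists2 e : R[i], 0 < e & [set xy | ball xy.1 e xy.2] `<=` E.
  by move: entE; rewrite -entourage_ballE.
have [d d0 dE] : exists2 d : R, 0 < d & e = d%:C.
  exists (complex.Re e); move: e0; rewrite ltcE /= => /andP[/eqP Ime Ree] //.
  exact: complex_ext.
pose nk := Num.sqrt (complex.Re kap ^+ 2 + complex.Im kap ^+ 2).
have nk0 : 0 <= nk := sqrtr_ge0 _.
have B0 : 0 <= nk * C by rewrite mulr_ge0.
have B1 : 0 < nk * C + 1 by rewrite ltr_wpDl.
apply: filterS (near_inv_sum_le _ _ (divr_gt0 d0 B1)) => N [N1 N2 N3 Ne].
apply: EU => tx Ktx; apply: ballE => /=.
have t0 : 0 < tx.1 := Kpos _ Ktx; have [tT xT] := KT _ Ktx.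
rewrite -ball_normE /= (psiE (tau, alpha, omega))// approxE// -mulrBr normrM.
rewrite (le_lt_trans (ler_wpM2l (normr_ge0 _) (HC N tx N1 N2 N3 tT xT)))//.
rewrite dE normc_def -/nk -rmorphM ltcR mulrA.
rewrite (le_lt_trans (ler_wpM2l B0 Ne))// mulrCA gtr_pMr//.
by rewrite ltr_pdivrMr// mul1r ltrDl.
Qed.
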